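(* The family of bilinear forms $\mathbf{g}_\mu$, $\mu\in\mathcal{M}_+$, given by $$\mathbf{g}_\mu(\rho,\xi)=a^2h_\rho h_\xi+b^2\langle\nabla\psi_\rho,\nabla\psi_\xi\rangle_\mu,\qquad \rho,\xi\in T_\mu\mathcal{M}_+=\mathbb{R}^{\mathcal{X}},$$ defines a smooth Riemannian metric on $\mathcal{M}_+$. Moreover, the induced length distance $\mathrm{dist}_{\mathbf{g}}$ coincides with the dynamic distance $\mathcal{W}^{a,b}_p$.
   Context: Setting. $\mathcal{X}$ is a finite set with $N$ points, $K:\mathcal{X}\times\mathcal{X}\to[0,\infty)$ is an irreducible Markov kernel (row-stochastic matrix), and $\varpi:\mathcal{X}\to[0,\infty)$ is its unique steady-state probability distribution ($\varpi(x)=\sum_{y}\varpi(y)K(y,x)$, $\sum_y\varpi(y)=1$). $\varpi$ is assumed reversible: $K(x,y)\varpi(x)=K(y,x)\varpi(y)$ for all $x,y$. $\mathcal{M}=\{\mu:\mathcal{X}\to\mathbb{R}\mid \mu(x)\ge 0\ \forall x\}$ and $\mathcal{M}_+=\{\mu:\mathcal{X}\to\mathbb{R}\mid\mu(x)>0\ \forall x\}$, an open subset of $\mathbb{R}^{\mathcal{X}}$, so $T_\mu\mathcal{M}_+=\mathbb{R}^{\mathcal{X}}$ for $\mu\in\mathcal{M}_+$. For $\psi\in\mathbb{R}^{\mathcal X}$, $\|\psi\|_{\varpi,1}=\sum_x\varpi(x)|\psi(x)|$. Fixed throughout: real numbers $a,b>0$ and $p\in\mathcal{M}_+$ with $\|p\|_{\varpi,1}=1$.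 Logarithmic mean: for $u,v\ge 0$, $\theta(u,v)=\int_0^1u^{\xi}v^{1-\xi}\,d\xi$, i.e. $\theta(u,u)=u$, $\theta(u,v)=\frac{u-v}{\log u-\log v}$ for $u\ne v$ both positive, and $\theta(u,v)=0$ if $u=0$ or $v=0$. For $\mu\in\mathcal{M}$, $\hat\mu(x,y):=\theta(\mu(x),\mu(y))$. Discrete calculus: $\nabla\psi(x,y)=\psi(y)-\psi(x)$; for $\Phi,\Psi\in\mathbb{R}^{\mathcal{X}\times\mathcal{X}}$, $\langle\Phi,\Psi\rangle_\mu=\frac12\sum_{x,y}\Phi(x,y)\Psi(x,y)\hat\mu(x,y)K(x,y)\varpi(x)$ and $(\nabla_\mu\cdot\Psi)(x)=\frac12\sum_y(\Psi(x,y)-\Psi(y,x))\hat\mu(x,y)K(x,y)$. Tangent decomposition: for $\mu\in\mathcal{M}_+$ and every $\rho\in\mathbb{R}^{\mathcal{X}}$ there is a unique pair $(\nabla\psi_\rho,h_\rho)$, consisting of a discrete gradient and a real number, with $\rho+\nabla_\mu\cdot\nabla\psi_\rho=h_\rho\,p$. These are the $\nabla\psi_\rho,h_\rho$ (and likewise $\nabla\psi_\xi,h_\xi$) in the definition of $\mathbf{g}_\mu$. Length distance: for $\mu_0,\mu_1\in\mathcal{M}_+$, $\mathrm{dist}_{\mathbf{g}}(\mu_0,\mu_1)$ is the infimum of $\int_0^1\sqrt{\mathbf{g}_{\mu_t}(\dot\mu_t,\dot\mu_t)}\,dt$ over absolutely continuous curves $\mu:[0,1]\to\mathcal{M}_+$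 joining $\mu_0$ to $\mu_1$. Dynamic distance: for $\mu_0,\mu_1\in\mathcal{M}$, $\mathrm{CE}_p(\mu_0,\mu_1;[0,1])$ is the set of triples $(\mu_t,\psi_t,h_t)_{t\in[0,1]}$ such that $t\mapsto\mu_t\in\mathcal{M}$ is absolutely continuous, $t\mapsto\psi_t\in\mathbb{R}^{\mathcal{X}}$ and $t\mapsto h_t\in\mathbb{R}$ are measurable, $\dot\mu_t+\nabla_{\mu_t}\cdot\nabla\psi_t=h_tp$ for a.e. $t\in[0,1]$, and $\mu_t|_{t=0}=\mu_0$, $\mu_t|_{t=1}=\mu_1$. Then $\mathcal{W}^{a,b}_p(\mu_0,\mu_1)\ge 0$ is defined by $$\mathcal{W}^{a,b}_p(\mu_0,\mu_1)^2:=\inf\Big\{a^2\int_0^1h_t^2\,dt+b^2\int_0^1\langle\nabla\psi_t,\nabla\psi_t\rangle_{\mu_t}\,dt\Big\},$$ the infimum being over $\mathrm{CE}_p(\mu_0,\mu_1;[0,1])$. *)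

(* Defs.v *)
From HB Require Import structures.
From mathcomp Require Import all_boot all_order all_algebra.
From mathcomp Require Import all_classical all_reals all_analysis.

Set Implicit Arguments.
Unset Strict Implicit.
Unset Printing Implicit Defensive.

Import Order.TTheory GRing.Theory Num.Theory.
Import numFieldNormedType.Exports.

Local Open Scope classical_set_scope.
Local Open Scope ring_scope.

Section MarkovKernel.
Context {R : realType} {X : finType}.
Implicit Types (K : X -> X -> R) (varpi mu psi : X -> R).

Definition markov_kernel K : Prop :=
  (forall x y, 0 <= K x y) /\ (forall x, \sum_y K x y = 1).

Definition irreducible_kernel K : Prop :=
  forall x y, connect (fun u v => 0 < K u v) x y.

Definition steady_state K varpi : Prop :=
  [/\ forall x, 0 <= varpi x,
      \sum_x varpi x = 1
    & forall x, varpi x = \sum_y varpi y * K y x].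

Definition reversible K varpi : Prop :=
  forall x y, K x y * varpi x = K y x * varpi y.

Definition measures : set (X -> R) := [set mu | forall x, 0 <= mu x].
Definition pos_measures : set (X -> R) := [set mu | forall x, 0 < mu x].

Definition l1norm varpi psi : R := \sum_x varpi x * `|psi x|.

End MarkovKernel.

Section DiscreteCalculus.
Context {R : realType} {X : finType}.
Implicit Types (K Phi Psi : X -> X -> R) (varpi p mu psi rho xi : X -> R).

(* At u = 0 or v = 0 the convention 0 `^ 0 = 1 only affects an endpoint of
   the domain of integration, so the integral vanishes as it should. *)
Definition logmean (u v : R) : R :=
  \int[lebesgue_measure]_(t in `[0, 1]) (u `^ t * v `^ (1 - t)).

Definition edge_mean mu (x y : X) : R := logmean (mu x) (mu y).

Definition dgrad psi : X -> X -> R := fun x y => psi y - psi x.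

Definition edge_inner K varpi mu Phi Psi : R :=
  2^-1 * \sum_x \sum_y
    Phi x y * Psi x y * edge_mean mu x y * K x y * varpi x.

Definition ddiv K mu Psi : X -> R := fun x =>
  2^-1 * \sum_y (Psi x y - Psi y x) * edge_mean mu x y * K x y.

Definition tangent_decomposition K p mu rho : set ((X -> X -> R) * R) :=
  [set Psih | (exists psi, Psih.1 = dgrad psi) /\
              forall x, rho x + ddiv K mu Psih.1 x = Psih.2 * p x].

(* The pair (dgrad psi_rho, h_rho).  For an irreducible reversible kernel and
   mu, p positive the decomposition exists and is unique, so the default value
   is irrelevant. *)
Definition tangent_pair K p mu rho : (X -> X -> R) * R :=
  xget (fun _ _ => 0, 0) (tangent_decomposition K p mu rho).

Definition tangent_grad K p mu rho : X -> X -> R := (tangent_pair K p mu rho).1.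
Definition tangent_h K p mu rho : R := (tangent_pair K p mu rho).2.

Definition metric K varpi p (a b : R) mu rho xi : R :=
  a ^+ 2 * tangent_h K p mu rho * tangent_h K p mu xi +
  b ^+ 2 * edge_inner K varpi mu (tangent_grad K p mu rho)
                                 (tangent_grad K p mu xi).

End DiscreteCalculus.

Section Smoothness.
Context {R : realType}.

Fixpoint Ck_on (V : normedModType R) (k : nat) (U : set V) (f : V -> R) : Prop :=
  match k with
  | 0 => forall x, U x -> {for x, continuous f}
  | k'.+1 => (forall x, U x -> differentiable f x) /\
             forall v, Ck_on k' U ('D_v f)
  end.

(* C^infinity; only meaningful for open U, as Ck_on uses full neighbourhoods *)
Definition smooth_on (V : normedModType R) (U : set V) (f : V -> R) : Prop :=
  forall k, Ck_on k U f.

(* R^X is identified with the normed space of row vectors by enumerating X. *)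
Definition fun_of_row (X : finType) (v : 'rV[R]_#|X|) : X -> R :=
  fun x => v ord0 (enum_rank x).

(* A tensor field on the positive orthant is smooth iff its coefficients are
   smooth in the global chart; rho and xi are constant vector fields. *)
Definition smooth_riemannian_metric (X : finType)
    (g : (X -> R) -> (X -> R) -> (X -> R) -> R) : Prop :=
  (forall mu, pos_measures mu ->
     [/\ bilinear_for *%R *%R (g mu),
         forall rho xi, g mu rho xi = g mu xi rho
       & forall rho, rho <> (fun=> 0) -> 0 < g mu rho rho]) /\
  (forall rho xi : X -> R,
     smooth_on (@fun_of_row X @^-1` pos_measures)
               (fun v => g (fun_of_row v) rho xi)).

End Smoothness.

Section Distances.
Context {R : realType} {X : finType}.
Implicit Types (K : X -> X -> R) (varpi p : X -> R) (mu : R -> X -> R).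
Local Notation leb := (@lebesgue_measure R).

Definition abs_continuous (c d : R) (f : R -> R) : Prop :=
  forall e : R, 0 < e -> exists2 delta : R, 0 < delta &
    forall (n : nat) (s t : 'I_n -> R),
      (forall i, c <= s i /\ s i <= t i /\ t i <= d) ->
      trivIset setT (fun i => `]s i, t i[%classic) ->
      \sum_i (t i - s i) < delta ->
      \sum_i `|f (t i) - f (s i)| < e.

Definition ac_curve mu : Prop :=
  forall x, abs_continuous 0 1 (fun t => mu t x).

(* The derivative of an absolutely continuous curve exists a.e. on [0, 1]; at
   the other points derive1 is a junk value, on a null set. *)
Definition velocity mu (t : R) : X -> R := fun x => derive1 (fun s => mu s x) t.

Definition joining_curves (m0 m1 : X -> R) : set (R -> X -> R) :=
  [set mu | [/\ ac_curve mu,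
                forall t : R, t \in `[0, 1] -> pos_measures (mu t),
                mu 0 = m0
              & mu 1 = m1]].

Definition curve_length (g : (X -> R) -> (X -> R) -> (X -> R) -> R) mu : \bar R :=
  (\int[leb]_(t in `[0%R, 1%R])
     (Num.sqrt (g (mu t) (velocity mu t) (velocity mu t)))%:E)%E.

Definition length_dist (g : (X -> R) -> (X -> R) -> (X -> R) -> R)
    (m0 m1 : X -> R)
    : \bar R :=
  ereal_inf [set curve_length g mu | mu in joining_curves m0 m1].

(* Measurability is Borel measurability; {ae leb, ...} allows any subset of a
   Lebesgue null set. *)
Record CE K p (m0 m1 : X -> R) mu (psi : R -> X -> R) (h : R -> R) : Prop := {
  CE_ac : ac_curve mu;
  CE_measures : forall t : R, t \in `[0, 1] -> measures (mu t);
  CE_measurable_psi : forall x, measurable_fun (`[0, 1] : set R) (fun t => psi t x);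
  CE_measurable_h : measurable_fun (`[0, 1] : set R) h;
  CE_equation : {ae leb, forall t : R, t \in `[0, 1] ->
    forall x, velocity mu t x + ddiv K (mu t) (dgrad (psi t)) x = h t * p x};
  CE_start : mu 0 = m0;
  CE_end : mu 1 = m1 }.

Definition action K varpi (a b : R) mu (psi : R -> X -> R) (h : R -> R)
    : \bar R :=
  ((a ^+ 2)%:E * \int[leb]_(t in `[0%R, 1%R]) (h t ^+ 2)%:E +
   (b ^+ 2)%:E * \int[leb]_(t in `[0%R, 1%R])
     (edge_inner K varpi (mu t) (dgrad (psi t)) (dgrad (psi t)))%:E)%E.

Definition dynamic_dist K varpi p (a b : R) (m0 m1 : X -> R) : \bar R :=
  sqrte (ereal_inf [set A | exists mu psi h,
    CE K p m0 m1 mu psi h /\ A = action K varpi a b mu psi h]).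

End Distances.

(* Main.v *)
(** Summing the tangent equation against [varpi] kills the divergence, so
    [h_rho] is the [varpi]-mean of [rho] and does not depend on [mu]; the
    potential solves a weighted Laplace equation whose coefficients are
    logarithmic means [v * phi (ln u - ln v)] with
    [phi s = \int_0^1 exp (t s) dt], so Cramer's rule makes the metric smooth.

    The two distances are compared through one inequality.  Among all edge
    fields with a given divergence the gradient has least action, and a flux
    admissible at [mu] can be transported to [mu0]; hence
    [g_mu0 (rho, rho) <= a^2 h^2 + b^2 kappa |grad psi|^2_mu] whenever
    [edge_mean mu <= kappa * edge_mean mu0], where monotonicity and homogeneity
    of the logarithmic mean supply [kappa].

    - [dist <= W]: replace an admissible curve [mu_t] by
      [(1 - d) mu_t + d ((1 - t) m0 + t m1)], which is positive and has the same
      end points; its speed is at most the square root of the action density of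
      [mu_t] plus [O(sqrt d)].
    - [W <= dist]: reparametrise a positive curve by (slightly increased) arc
      length.  The new curve is Lipschitz and its metric speed is a.e. at most
      the total length: near a point the metrics along the curve are comparable
      up to a factor close to 1, and the metric norm of an increment is at most
      the integral of the speed.

    Both directions use that an absolutely continuous function is a.e.
    differentiable and is the integral of its derivative: its variation
    function generates a Stieltjes measure dominated by the Lebesgue measure
    (open sets are disjoint unions of intervals), to which Radon-Nikodym and
    Lebesgue differentiation apply. *)

From HB Require Import structures.
Require Import Defs.
From mathcomp Require Import all_boot all_order all_algebra.
From mathcomp Require Import all_classical all_reals all_analysis.
From mathcomp Require Import measurable_realfun ring lra.

Set Implicit Arguments.
Unset Strict Implicit.
Unset Printing Implicit Defensive.

Import Order.TTheory GRing.Theory Num.Theory.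
Import numFieldNormedType.Exports.

Local Open Scope classical_set_scope.
Local Open Scope ring_scope.

(** * Absolutely continuous functions *)

Section NonOverlapping.
Context {R : realType}.
Implicit Types (L : seq (R * R)) (f : R -> R).

(** The order of the list is immaterial and end points may touch. Lists are easier to concatenate
    and refine than the indexed families of [abs_continuous]. *)
Definition non_overlapping L : bool :=
  all (fun u => u.1 <= u.2) L &&
  pairwise (fun u v => (u.2 <= v.1) || (v.2 <= u.1)) L.

Lemma non_overlapping_cat L1 L2 : non_overlapping (L1 ++ L2) =
  [&& non_overlapping L1, non_overlapping L2 &
      allrel (fun u v => (u.2 <= v.1) || (v.2 <= u.1)) L1 L2].
Proof.
rewrite /non_overlapping all_cat pairwise_cat.
by case: all; case: all; case: allrel; case: pairwise; case: pairwise.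
Qed.

Definition partition_steps (a : R) (s : seq R) := zip (a :: s) s.

Lemma partition_stepsP a b s : itv_partition a b s ->
  [/\ non_overlapping (partition_steps a s),
      forall u, u \in partition_steps a s -> a <= u.1 /\ u.2 <= b
    & \sum_(u <- partition_steps a s) (u.2 - u.1) = b - a].
Proof.
rewrite /partition_steps.
elim: s a => [|x s IH] a.
  by move=> /itv_partition_nil ->; split => //; rewrite big_nil subrr.
move=> /= abs.
have /andP[ax xs] : (a < x) && path <%R x s by case: abs.
have xbs : itv_partition x b s by case: abs => _; split.
have [nov ins sumE] := IH _ xbs.
have xb := itv_partition_le xbs.
split.
- move: nov; rewrite /non_overlapping /= (ltW ax) => /andP[-> ->]; rewrite !andbT.
  by apply/allP => u /ins[xu _] /=; rewrite xu.
- move=> u; rewrite in_cons => /predU1P[->//|/ins[xu ub]]; split => //.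
  exact: (le_trans (ltW ax)).
- by rewrite big_cons sumE /= addrC subrKA.
Qed.

Lemma variation_steps a b f s : itv_partition a b s ->
  variation a b f s = \sum_(u <- partition_steps a s) `|f u.2 - f u.1|.
Proof.
move=> abs; rewrite variation_zip//; move: abs => _.
elim: s a => [|x s IH] a; first by rewrite !big_nil.
by rewrite /= !big_cons IH.
Qed.

(** Absolute continuity on the whole line. A function given on [[c, d]] enters through composition
    with [clamp c d], which removes side conditions on the end points. *)
Definition ac_line f := forall e : R, 0 < e -> exists2 delta : R, 0 < delta &
  forall L, non_overlapping L -> \sum_(u <- L) (u.2 - u.1) < delta ->
    \sum_(u <- L) `|f u.2 - f u.1| < e.

Definition clamp (c d x : R) : R := Num.max c (Num.min x d).

Lemma clamp_itv c d x : c <= d -> c <= clamp c d x <= d.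
Proof. by move=> cd; rewrite /clamp le_max lexx /= ge_max cd ge_min lexx orbT. Qed.

Lemma clamp_id c d x : c <= x <= d -> clamp c d x = x.
Proof. by rewrite /clamp => /andP[cx xd]; rewrite (min_idPl xd) (max_idPr cx). Qed.

Lemma clamp_homo c d : {homo clamp c d : x y / x <= y}.
Proof.
move=> x y xy; rewrite /clamp ge_max !le_max lexx /= le_min !ge_min lexx xy /=.
by rewrite orbT orbT.
Qed.

Lemma clamp_dist c d x y : x <= y -> clamp c d y - clamp c d x <= y - x.
Proof.
move=> xy; rewrite /clamp.
have h1 : Num.min x d <= Num.min y d by rewrite le_min !ge_min lexx xy /= orbT.
have h2 : Num.min y d - Num.min x d <= y - x.
  by case: (leP x d) => ?; case: (leP y d) => ?; lra.
by move: h1 h2; set x' := Num.min x d; set y' := Num.min y d => h1 h2;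
  case: (leP c x') => ?; case: (leP c y') => ?; lra.
Qed.

(** Clamping is monotone and 1-Lipschitz, so it keeps intervals disjoint and does not increase their
    total length. *)
Lemma abs_continuous_ac_line c d f : c <= d -> abs_continuous c d f ->
  ac_line (f \o clamp c d).
Proof.
move=> cd acf e /acf[delta d0 H]; exists delta => // L /andP[/allP Lle Lp] Ls.
pose s (i : 'I_(size L)) := clamp c d (nth (0, 0) L i).1.
pose t (i : 'I_(size L)) := clamp c d (nth (0, 0) L i).2.
rewrite (big_nth (0, 0)) big_mkord.
apply: (H _ s t).
- move=> i; have /andP[cs _] := clamp_itv (nth (0, 0) L i).1 cd.
  have /andP[_ td] := clamp_itv (nth (0, 0) L i).2 cd.
  split => //; split => //; apply: clamp_homo; apply: Lle; exact: mem_nth.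
- apply/trivIsetP => i j _ _ ij.
  wlog lij : i j ij / (i < j)%N.
    move=> W; case: (ltngtP i j) => [|ji|/val_inj ijE]; first exact: W.
      by rewrite setIC; apply: W => //; rewrite eq_sym.
    by rewrite ijE eqxx in ij.
  apply/seteqP; split => // x /=; rewrite !in_itv /= => -[/andP[sx xt] /andP[sx' xt']].
  have := pairwiseP (0, 0) Lp i j (ltn_ord _) (ltn_ord _) lij.
  move=> /orP[/(clamp_homo c d) h|/(clamp_homo c d) h].
    by have := lt_trans sx' (lt_le_trans xt h); rewrite ltxx.
  by have := lt_trans sx (lt_le_trans xt' h); rewrite ltxx.
- apply: le_lt_trans Ls; rewrite [leRHS](big_nth (0, 0)) big_mkord.
  by apply: ler_sum => i _; apply: clamp_dist; apply: Lle; exact: mem_nth.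
Qed.

Lemma ac_line_sub f e delta : 0 < e ->
  (forall L, non_overlapping L -> \sum_(u <- L) (u.2 - u.1) < delta ->
    \sum_(u <- L) `|f u.2 - f u.1| < e) ->
  forall x y, `|y - x| < delta -> `|f y - f x| < e.
Proof.
move=> e0 H x y; wlog xy : x y / x <= y => [W|].
  have [/W//|/ltW yx] := leP x y.
  by rewrite distrC => /(W _ _ yx); rewrite distrC.
rewrite ger0_norm ?subr_ge0// => xyd.
have := H [:: (x, y)]; rewrite /non_overlapping /= xy !big_seq1 /=.
by apply.
Qed.

Lemma ac_line_continuous f : ac_line f -> continuous f.
Proof.
move=> acf x; apply/cvgrPdist_lt => e e0.
have [delta d0 H] := acf _ e0.
near=> y; apply: (ac_line_sub e0 H).
by near: y; apply: cvgr_dist_lt.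
Unshelve. all: by end_near. Qed.

(** With [delta] the modulus for the value 1, an interval shorter than [delta] has variation at most
    1; the induction counts the pieces of length [delta / 2] needed to cover the interval. *)
Lemma ac_line_BV f c d : c < d -> ac_line f -> bounded_variation c d f.
Proof.
move=> cd acf; have [delta d0 H] := acf _ (@ltr01 R).
suff K n : forall s t, s <= t -> t - s <= n%:R * (delta / 2) ->
    (total_variation s t f <= n%:R%:E)%E.
  apply/(bounded_variationP _ (ltW cd)).
  rewrite ge0_fin_numE ?total_variation_ge0 ?ltW//.
  apply: (le_lt_trans (K (Num.bound ((d - c) / (delta / 2))) _ _ (ltW cd) _)); last exact: ltry.
  rewrite -ler_pdivrMr ?divr_gt0//; apply/ltW/archi_boundP.
  by rewrite divr_ge0 ?subr_ge0// ltW ?divr_gt0.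
elim: n => [s t st|n IH s t st tsn].
  rewrite mul0r subr_le0 => ts; have <- : s = t by apply/eqP; rewrite eq_le st.
  by rewrite total_variationxx.
pose m := Num.min t (s + delta / 2).
have h0 : 0 < delta / 2 by rewrite divr_gt0.
have sm : s <= m by rewrite le_min st lerDl ltW.
have mt : m <= t by rewrite ge_min lexx.
have -> : (n.+1%:R%:E = 1%:E + n%:R%:E :> \bar R)%E by rewrite -EFinD addrC natr1.
rewrite (total_variationD f sm mt); apply: leeD; last first.
  apply: IH => //; rewrite /m; case: (leP t (s + delta / 2)) => h.
    by rewrite subrr mulr_ge0// ltW.
  by move: tsn; rewrite -natr1 mulrDl mul1r; lra.
apply: ge_ereal_sup => _ [_ [l ml <-] <-]; rewrite lee_fin variation_steps//.
have [nov _ sumE] := partition_stepsP ml.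
apply/ltW/H => //; rewrite sumE.
have : m <= s + delta / 2 by rewrite ge_min lexx orbT.
lra.
Qed.

End NonOverlapping.

(** * Absolute continuity of the variation function *)

Section VariationAC.
Context {R : realType}.
Implicit Types (L : seq (R * R)) (f : R -> R).

(* The intervals of [L1] are replaced one by one by the steps of partitions. *)
Lemma ac_line_variation f (c d e delta : R) :
  bounded_variation c d f ->
  (forall L, non_overlapping L -> \sum_(u <- L) (u.2 - u.1) < delta ->
    \sum_(u <- L) `|f u.2 - f u.1| < e) ->
  forall L1 L2, (forall u, u \in L1 -> c <= u.1 /\ u.2 <= d) ->
    non_overlapping (L1 ++ L2) ->
    \sum_(u <- L1 ++ L2) (u.2 - u.1) < delta ->
    \sum_(u <- L1) fine (total_variation u.1 u.2 f) +
      \sum_(u <- L2) `|f u.2 - f u.1| <= e.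
Proof.
move=> bvf H; elim=> [|[s t] L1 IH] L2 inL nov suml.
  by rewrite big_nil add0r ltW// H.
have st : s <= t by move: nov => /andP[/=/andP[]].
have [/= cs td] := inL _ (mem_head _ _).
have bvst : bounded_variation s t f.
  apply: (@bounded_variationl _ s t d) => //; apply: (@bounded_variationr _ c s d) => //.
  exact: le_trans td.
have fTV : total_variation s t f \is a fin_num by apply/bounded_variationP.
rewrite big_cons /=; set A := \sum_(u <- L1) _; set B := \sum_(u <- L2) _.
suff : (total_variation s t f <= (e - A - B)%:E)%E.
  by rewrite -[X in (X <= _)%E](fineK fTV) lee_fin; lra.
(* The variation is bounded one partition [l] at a time: the steps of [l] replace [(s, t)] and join
   [L2], where the induction hypothesis covers them. *)
apply: ge_ereal_sup => _ [_ [l stl <-] <-]; rewrite lee_fin variation_steps//.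
have [novP insP sumP] := partition_stepsP stl.
suff : A + \sum_(u <- partition_steps s l ++ L2) `|f u.2 - f u.1| <= e.
  by rewrite big_cat /= -/B; lra.
apply: IH.
- by move=> u uL; apply: inL; rewrite in_cons uL orbT.
- move: nov; rewrite -cat1s -catA !non_overlapping_cat !allrel_catr.
  move=> /and3P[_ /and3P[-> -> h12] /andP[h1 h2]]; rewrite novP h12 !andbT /=.
  have hP (L : seq (R * R)) :
      allrel (fun u v : R * R => (u.2 <= v.1) || (v.2 <= u.1)) [:: (s, t)] L ->
      allrel (fun u v => (u.2 <= v.1) || (v.2 <= u.1)) (partition_steps s l) L.
    move=> /allrelP h; apply/allrelP => u v /insP[su ut] vL.
    have := h (s, t) v (mem_head _ _) vL => /= /orP[tv|vs].
      by rewrite (le_trans ut tv).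
    by rewrite (le_trans vs su) orbT.
  rewrite hP//= allrelC; apply/allrelP => u v uP vL.
  by have /allrelP/(_ _ _ uP vL) := hP _ h1; rewrite orbC.
- move: suml; rewrite !big_cat /= !big_cons /= sumP.
  lra.
Qed.

(** The clamp extends the variation function by constants outside [[c, d]], so that it is monotone
    on the whole line and can generate a Stieltjes measure. *)
Definition running_variation c d f x : R := fine (total_variation c (clamp c d x) f).

Lemma running_variation_sub c d f x y : c < d -> ac_line f -> x <= y ->
  running_variation c d f y - running_variation c d f x =
  fine (total_variation (clamp c d x) (clamp c d y) f).
Proof.
move=> cd acf xy; rewrite /running_variation.
have /andP[cx xd] := clamp_itv x (ltW cd).
have /andP[cy yd] := clamp_itv y (ltW cd).
have bvf := ac_line_BV cd acf.
have xy' := clamp_homo c d xy.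
rewrite (total_variationD f cx xy') fineD.
- by rewrite addrC addKr.
- by apply/bounded_variationP => //; exact: bounded_variationl bvf.
- apply/bounded_variationP => //; apply: (@bounded_variationr _ c) => //.
  exact: bounded_variationl bvf.
Qed.

Lemma running_variation_ge c d f x y : c < d -> ac_line f -> x <= y ->
  `|f (clamp c d y) - f (clamp c d x)| <=
  running_variation c d f y - running_variation c d f x.
Proof.
move=> cd acf xy; rewrite running_variation_sub//.
have /andP[cx xd] := clamp_itv x (ltW cd).
have /andP[cy yd] := clamp_itv y (ltW cd).
have bvf := ac_line_BV cd acf.
have xy' := clamp_homo c d xy.
have fin : total_variation (clamp c d x) (clamp c d y) f \is a fin_num.
  apply/bounded_variationP => //; apply: (@bounded_variationr _ c) => //.
  exact: bounded_variationl bvf.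
by rewrite -lee_fin fineK// total_variation_ge.
Qed.

Lemma running_variation_homo c d f : c < d -> ac_line f ->
  {homo running_variation c d f : x y / x <= y}.
Proof.
move=> cd acf x y xy; rewrite -subr_ge0.
exact: le_trans (running_variation_ge cd acf xy).
Qed.

Lemma ac_line_running_variation c d f : c < d -> ac_line f ->
  ac_line (running_variation c d f).
Proof.
(* Half of [e] is used because [ac_line_variation] yields only a non-strict bound. *)
move=> cd acf e e0; have e20 : 0 < e / 2 by rewrite divr_gt0.
have [delta d0 H] := acf _ e20; exists delta => // L nov suml.
have /andP[/allP Lle Lp] := nov.
pose L' := [seq (clamp c d u.1, clamp c d u.2) | u <- L].
have := ac_line_variation (ac_line_BV cd acf) H (L1 := L') (L2 := [::]).
rewrite cats0 big_nil addr0 => /(_ _ _ _).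
rewrite !big_map => K.
apply: (@le_lt_trans _ _ (e / 2)); last by rewrite gtr_pMr// invf_lt1// ltr1n.
apply: le_trans (K _ _ _).
- rewrite big_seq [leRHS]big_seq; apply: ler_sum => u uL.
  rewrite ger0_norm ?subr_ge0 ?running_variation_homo ?Lle//.
  by rewrite running_variation_sub ?Lle.
- move=> u /mapP[v vL ->] /=.
  by have /andP[-> _] := clamp_itv v.1 (ltW cd); have /andP[_ ->] := clamp_itv v.2 (ltW cd).
- apply/andP; split.
    by apply/allP => u /mapP[v vL ->] /=; apply: clamp_homo; exact: Lle.
  rewrite pairwise_map; apply: sub_pairwise Lp => u v /= /orP[h|h].
    by rewrite clamp_homo.
  by rewrite (clamp_homo _ _ h) orbT.
- apply: le_lt_trans suml; rewrite big_seq [leRHS]big_seq; apply: ler_sum => u uL.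
  by apply: clamp_dist; exact: Lle.
Qed.

End VariationAC.

(** * Densities of monotone absolutely continuous functions *)

Section ACDensity.
Context {R : realType}.
Local Notation leb := (@lebesgue_measure R).

Lemma lebesgue_itvcc_le (I : set R) (x y : R) : measurable I -> is_interval I ->
  I x -> I y -> ((y - x)%:E <= leb I)%E.
Proof.
move=> mI iI Ix Iy; have [xy|yx] := leP x y; last first.
  by apply: (@le_trans _ _ 0%E); rewrite // lee_fin subr_le0 ltW.
apply: (@le_trans _ _ (leb `[x, y]%classic)).
  rewrite lebesgue_measure_itv /= lte_fin; case: ifPn => // xy'.
  by rewrite lee_fin subr_le0 leNgt.
apply: le_measure; rewrite ?inE// => z /=; rewrite in_itv /= => /andP[xz zy].
by apply: (iI _ _ Ix Iy); rewrite xz.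
Qed.

(** Finite measure bounds the interval on both sides, and its infimum and supremum are then the end
    points. *)
Lemma open_interval_itvoo (I : set R) : open I -> is_interval I ->
  (leb I < +oo)%E -> exists u : R * R, u.1 <= u.2 /\ I = `]u.1, u.2[%classic.
Proof.
move=> oI iI finI.
have [->|/set0P[r Ir]] := eqVneq I set0.
  by exists (0, 0); rewrite lexx set_itv_ge// bnd_simp ltxx.
have mI : measurable I by exact: open_measurable.
have finI' : leb I \is a fin_num by rewrite ge0_fin_numE.
have ubI : has_ubound I.
  exists (r + fine (leb I)) => y Iy; rewrite -lerBlDl -lee_fin fineK//.
  exact: lebesgue_itvcc_le.
have lbI : has_lbound I.
  exists (r - fine (leb I)) => y Iy; rewrite lerBlDr -lerBlDl -lee_fin fineK//.
  exact: lebesgue_itvcc_le.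
exists (inf I, sup I) => /=; split.
  by apply: (@le_trans _ _ r); [exact: ge_inf|exact: ub_le_sup].
have IE : interior I = I by apply/interior_id.
rewrite -[LHS]IE interval_bounded_interior//; by apply/seteqP; split => x /=; rewrite in_itv.
Qed.

Lemma itvoo_disjoint (a b c d : R) : a < b -> c < d ->
  `]a, b[ `&` `]c, d[ = set0 :> set R -> (b <= c) || (d <= a).
Proof.
move=> ab cd H; apply/negPn/negP; rewrite negb_or -!ltNge => /andP[cb ad].
pose l := Num.max a c; pose u := Num.min b d.
have lu : l < u by rewrite lt_min !gt_max ab cb ad cd.
have : (`]a, b[ `&` `]c, d[) ((l + u) / 2).
  have [h1 h2] := (midf_lt lu); split; rewrite /= in_itv /=; apply/andP; split.
  - by apply: le_lt_trans h1; rewrite le_max lexx.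
  - by apply: lt_le_trans h2 _; rewrite ge_min lexx.
  - by apply: le_lt_trans h1; rewrite le_max lexx orbT.
  - by apply: lt_le_trans h2 _; rewrite ge_min lexx orbT.
by rewrite H.
Qed.

Lemma stieltjes_itvoc (G : cumulative R R) (s t : R) : s <= t ->
  lebesgue_stieltjes_measure G `]s, t]%classic = (G t - G s)%:E.
Proof.
move=> st; rewrite /lebesgue_stieltjes_measure /measure_extension.
by rewrite measurable_mu_extE/= ?wlength_itv_bnd//; exact: is_ocitv.
Qed.

(** By outer regularity [N] lies in an open set of Lebesgue measure below [delta]. Its components
    are disjoint intervals, any finitely many of which carry increments of [G] summing to less than
    [e]; the bound survives the limit. *)
Lemma ac_line_stieltjes_dominates (G : cumulative R R) (N : set R) :
  ac_line G -> measurable N -> leb N = 0 ->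
  lebesgue_stieltjes_measure G N = 0.
Proof.
move=> acG mN N0; apply/eqP; rewrite eq_le measure_ge0 andbT.
apply/lee_addgt0Pr => e e0; rewrite add0e.
have [delta d0 H] := acG _ e0.
have finN : (leb N < +oo)%E by rewrite N0 ltry.
have [U [oU NU UNd]] := lebesgue_regularity_outer mN finN d0.
have mU : measurable U by exact: open_measurable.
have Ud : (leb U < delta%:E)%E.
  apply: le_lt_trans UNd; rewrite -[leRHS]adde0 -[X in (_ <= _ + X)%E]N0 addeC.
  rewrite -{1}(setDUK NU); apply: measureU2 => //; exact: measurableD.
apply: (@le_trans _ _ (lebesgue_stieltjes_measure G U)).
  by apply: le_measure; rewrite ?inE.
pose I := open_disjoint_itv oU.
have tI : trivIset setT I by exact: open_disjoint_itv_trivIset.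
have UI : U = \bigcup_n I n by exact: open_disjoint_itv_bigcup.
have mI n : measurable (I n) by apply: open_measurable; exact: open_disjoint_itv_open.
have IU n : I n `<=` U by move=> x Ix; rewrite UI; exists n.
have /choice[u uP] : forall n, exists u : R * R, u.1 <= u.2 /\ I n = `]u.1, u.2[%classic.
  move=> n; apply: open_interval_itvoo.
  - exact: open_disjoint_itv_open.
  - exact: open_disjoint_itv_is_interval.
  - apply: (@le_lt_trans _ _ (leb U)); last exact: lt_trans Ud (ltry _).
    by apply: le_measure; rewrite ?inE; [exact: mI|exact: mU|exact: IU].
have lebI n : leb (I n) = ((u n).2 - (u n).1)%:E.
  have [u12 ->] := uP n; rewrite lebesgue_measure_itv /= lte_fin.
  by case: ltgtP u12 => // -> _; rewrite subrr.
rewrite UI measure_semi_bigcup//; last by rewrite -UI.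
apply: lime_le; first by apply: is_cvg_nneseries => n _ _.
apply: nearW => k.
apply: (@le_trans _ _ (\sum_(0 <= n < k) `|G (u n).2 - G (u n).1|%:E)%E).
  apply: lee_sum => n _; have [u12 IE] := uP n.
  apply: (@le_trans _ _ (lebesgue_stieltjes_measure G `](u n).1, (u n).2]%classic)).
    by rewrite IE; apply: le_measure; rewrite ?inE//; exact: subset_itv_oo_oc.
  by rewrite stieltjes_itvoc// lee_fin ler_norm.
rewrite sumEFin lee_fin.
(* Empty components are dropped: they contribute nothing to either sum, and disjointness orders the
   end points of two open intervals only when both are nonempty. *)
pose L := [seq u n | n <- iota 0 k & (u n).1 < (u n).2].
have zero (F : R -> R -> R) : (forall x, F x x = 0) ->
    \sum_(0 <= n < k) F (u n).1 (u n).2 = \sum_(v <- L) F v.1 v.2.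
  move=> F0; rewrite big_map big_filter /index_iota subn0 [RHS]big_mkcond.
  apply: eq_bigr => n _; case: ifPn => //; rewrite -leNgt => u21.
  by have [u12 _] := uP n; rewrite (@le_anti _ _ (u n).1 (u n).2) ?F0// u12.
rewrite (zero (fun x y => `|G y - G x|)); last by move=> x; rewrite subrr normr0.
apply/ltW/H; last first.
  rewrite -(zero (fun x y => y - x)); last by move=> x; rewrite subrr.
  rewrite -lte_fin -sumEFin (eq_bigr (fun n => leb (I n))); last by move=> n _; rewrite lebI.
  apply: le_lt_trans Ud; rewrite UI measure_semi_bigcup//; last by rewrite -UI.
  exact: nneseries_lim_ge.
apply/andP; split; first by apply/allP => v /mapP[n _ ->]; have [] := uP n.
rewrite pairwise_map; set s := seq.filter _ _.
have us : uniq s by rewrite filter_uniq// iota_uniq.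
have sP : all (fun n => (u n).1 < (u n).2) s by exact: filter_all.
move: us; rewrite uniq_pairwise; apply: sub_in_pairwise sP => n m un um /= nm.
apply: itvoo_disjoint => //.
have [_ <-] := uP n; have [_ <-] := uP m.
by move/trivIsetP : tI; apply.
Qed.

(** The density is the Radon-Nikodym derivative of the Stieltjes measure of [G]. Restricting that
    measure to []c, d]] makes it finite, hence the density integrable on the whole line. *)
Lemma nd_ac_density (G : R -> R) (c d : R) : c <= d ->
  {homo G : x y / x <= y} -> ac_line G ->
  exists phi : R -> R, leb.-integrable setT (EFin \o phi) /\
    forall s t, c <= s -> s <= t -> t <= d ->
      G t - G s = \int[leb]_(x in `]s, t]) phi x.
Proof.
move=> cd ndG acG.
have rcG : right_continuous G by apply/right_continuousW; exact: ac_line_continuous.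
pose Gc : cumulative R R := HB.pack G (isCumulative.Build R _ R G ndG rcG).
pose m := lebesgue_stieltjes_measure Gc.
have mcd : measurable (`]c, d]%classic : set (measurableTypeR R)) by exact: measurable_itv.
have fincd : (m `]c, d]%classic < +oo)%E by rewrite /m stieltjes_itvoc// ltry.
pose nu := mfrestr mcd fincd.
have dom : nu `<< leb.
  apply/null_content_dominatesP => N mN N0; rewrite /nu /mfrestr /mrestr.
  apply/eqP; rewrite eq_le measure_ge0 andbT.
  rewrite -(ac_line_stieltjes_dominates (G := Gc) acG mN N0).
  by apply: le_measure; rewrite ?inE//; exact: measurableI.
have [f [f0 ffin fint fE]] := radon_nikodym_sigma_finite dom.
have EFf : EFin \o (fine \o f) = f by apply/funext => x /=; rewrite fineK.
exists (fine \o f); rewrite EFf; split => // s t cs st td.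
rewrite /Rintegral (eq_integral f); last by move=> x _ /=; rewrite fineK.
rewrite -fE; last exact: measurable_itv.
rewrite /= /mfrestr /mrestr setIidl; last first.
  by apply: subset_itv; rewrite bnd_simp.
by rewrite (stieltjes_itvoc Gc).
Qed.

End ACDensity.

(** * The fundamental theorem of calculus for absolutely continuous functions *)

Section ACFTC.
Context {R : realType}.
Local Notation leb := (@lebesgue_measure R).

Lemma ac_lineB (f g : R -> R) : ac_line f -> ac_line g -> ac_line (f \- g).
Proof.
move=> acf acg e e0; have e20 : 0 < e / 2 by rewrite divr_gt0.
have [df df0 Hf] := acf _ e20; have [dg dg0 Hg] := acg _ e20.
exists (Num.min df dg); first by rewrite lt_min df0.
move=> L nov; rewrite lt_min => /andP[/(Hf _ nov) hf /(Hg _ nov) hg].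
rewrite [e]splitr; apply: le_lt_trans (ltrD hf hg).
rewrite -big_split /=; apply: ler_sum => u _.
have -> : (f \- g) u.2 - (f \- g) u.1 = (f u.2 - f u.1) - (g u.2 - g u.1).
  by rewrite /=; ring.
exact: ler_normB.
Qed.

(** Jordan decomposition: the clamped function [F] is [V - (V - F)] with [V] its running variation.
    Both terms are nondecreasing, since increments of [F] are bounded by those of [V], so both have
    densities; Lebesgue differentiation recovers the derivative a.e. *)
Lemma abs_continuous_FTC (c d : R) (f : R -> R) : c < d -> abs_continuous c d f ->
  exists phi : R -> R, [/\ leb.-integrable setT (EFin \o phi),
    forall s t, c <= s -> s <= t -> t <= d ->
      f t - f s = \int[leb]_(x in `]s, t]) phi x
  & {ae leb, forall t, t \in `]c, d[ -> is_derive t 1 f (phi t)}].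
Proof.
move=> cd /(abs_continuous_ac_line (ltW cd)); set F := f \o clamp c d => acF.
pose V := running_variation c d F.
have acV : ac_line V by exact: ac_line_running_variation.
have [phi1 [int1 E1]] := nd_ac_density (ltW cd) (running_variation_homo cd acF) acV.
have [|phi2 [int2 E2]] := nd_ac_density (ltW cd) _ (ac_lineB acV acF).
  move=> x y xy /=; have := running_variation_ge cd acF xy.
  rewrite /F /= !(clamp_id (clamp_itv _ (ltW cd))) => /(le_trans (ler_norm _)).
  by rewrite -/(V y) -/(V x); lra.
have FE x : c <= x -> x <= d -> F x = f x.
  by move=> cx xd; rewrite /F /= clamp_id// cx.
pose phi x := phi1 x - phi2 x.
have intphi : leb.-integrable setT (EFin \o phi).
  have -> : EFin \o phi = ((EFin \o phi1) \- (EFin \o phi2))%E by [].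
  exact: integrableB.
have phiE s t : c <= s -> s <= t -> t <= d ->
    f t - f s = \int[leb]_(x in `]s, t]) phi x.
  move=> cs st td; rewrite /phi RintegralB//.
  - rewrite -E1// -E2// /= !FE// ?(le_trans st)// ?(le_trans cs)//.
    by rewrite -/(V t) -/(V s); ring.
  - exact: integrableS int1.
  - exact: integrableS int2.
exists phi; split => //.
have FTC : {ae leb, forall x, (BRight c < BRight x)%O ->
    derivable (fun y => \int[leb]_(t in `]c, y]) phi t) x 1 /\
    derive1 (fun y => \int[leb]_(t in `]c, y]) phi t) x = phi x}.
  apply: (@FTC1 R phi (BRight c)); last exact: open_integrable_locally openT intphi.
  by move=> y; exact: integrableS intphi.
move: FTC; apply: filterS; first exact: (ae_filter_ringOfSetsType leb).
move=> x Fx xcd.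
have /andP[cx xd] : c < x < d by move: xcd; rewrite in_itv.
have [dF FE'] := Fx cx.
have near_f : \forall y \near x, \int[leb]_(t in `]c, y]) phi t + f c = f y.
  near=> y.
  have : y \in `]c, d[ by near: y; exact: near_in_itvoo.
  by rewrite in_itv /= => /andP[cy yd]; rewrite -phiE// ?ltW// subrK.
apply: near_eq_is_derive near_f _.
rewrite -[X in is_derive _ _ _ X]addr0.
apply: is_deriveD.
by apply: DeriveDef; [exact: dF|rewrite -derive1E].
Unshelve. all: by end_near. Qed.

End ACFTC.

(** * The logarithmic mean *)

Section LogMean.
Context {R : realType}.
Implicit Types (u v c s : R).
Local Notation leb := (@lebesgue_measure R).

(** The [n]-th derivative of [s |-> (expR s - 1) / s], extended by 1 at 0. The integral form has no
    singularity at 0, that is, on the diagonal of the logarithmic mean. *)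
Definition expmoment (n : nat) s : R :=
  \int[leb]_(t in `[0, 1]) (t ^+ n * expR (t * s)).

Lemma continuous_integrable_itv (f : R -> R) (x y : R) :
  continuous f -> leb.-integrable `[x, y] (EFin \o f).
Proof.
move=> cf; apply: continuous_compact_integrable; first exact: segment_compact.
exact: continuous_subspaceT.
Qed.

Lemma continuous_expmoment_integrand n s : continuous (fun t : R => t ^+ n * expR (t * s)).
Proof.
move=> t; apply: cvgM; first exact: exprn_continuous.
apply: continuous_cvg; first exact: continuous_expR.
by apply: cvgM; last exact: cvg_cst; exact: cvg_id.
Qed.

Lemma is_derive_expmoment n s : is_derive s 1 (expmoment n) (expmoment n.+1 s).
Proof.
pose f (s t : R) : R := t ^+ n * expR (t * s).
have df (x t : R) : is_derive x 1 (f ^~ t) (t ^+ n.+1 * expR (t * x)).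
  rewrite /f exprSr -mulrA; apply: is_deriveZ.
  have -> : t * expR (t * x) = expR (t * x) * t by rewrite mulrC.
  apply: (@is_derive1_comp _ expR (fun x => t * x)).
  have {2}-> : t = t *: 1 by rewrite scaler1.
  by apply: is_deriveZ.
have d1f (x t : R) : partial1of2 f x t = t ^+ n.+1 * expR (t * x).
  by rewrite partial1of2E; have [_ ->] := df x t.
(* For [x] in []s - 1, s + 1[] and [t] in [[0, 1]] the exponent [t * x] is at most |s| + 1, so a
   constant dominates the derivatives of the integrand. *)
pose G (t : R) : R := expR (`|s| + 1).
have Is : `]s - 1, s + 1[%classic s by rewrite /= in_itv /=; apply/andP; split; lra.
have intf x : `]s - 1, s + 1[%classic x -> leb.-integrable `[0, 1] (EFin \o f x).
  by move=> _; exact/continuous_integrable_itv/continuous_expmoment_integrand.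
have derf x t : `]s - 1, s + 1[%classic x -> `[0, 1]%classic t -> derivable (f ^~ t) x 1.
  by move=> _ _; have [] := df x t.
have G0 t : 0 <= G t by exact: expR_ge0.
have intG : leb.-integrable `[0, 1] (EFin \o G).
  by apply: continuous_integrable_itv => ?; exact: cst_continuous.
have Gub x t : `]s - 1, s + 1[%classic x -> `[0, 1]%classic t -> `|partial1of2 f x t| <= G t.
  rewrite /= !in_itv /= => /andP[sx xs] /andP[t0 t1].
  rewrite d1f normrM (ger0_norm (expR_ge0 _)) ger0_norm ?exprn_ge0//.
  rewrite -[leRHS]mul1r ler_pM ?exprn_ge0 ?expR_ge0 ?exprn_ile1//.
  rewrite ler_expR; apply: (@le_trans _ _ (t * (`|s| + 1))).
    by apply: ler_wpM2l => //; have := ler_norm s; lra.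
  by rewrite -[leRHS]mul1r ler_wpM2r// addr_ge0.
have mI : measurable (`[0, 1]%classic : set (measurableTypeR R)) by exact: measurable_itv.
have D := differentiation_under_integral mI Is intf derf G0 intG Gub.
have D' := derivable_under_integral mI Is intf derf G0 intG Gub.
apply: DeriveDef; first exact: D'.
rewrite -derive1E [LHS]D /expmoment.
by apply: eq_Rintegral => t _; rewrite d1f.
Qed.

Lemma continuous_powR_exponent u : 0 < u -> continuous (fun t => u `^ t).
Proof.
move=> u0; rewrite (_ : (fun t => _) = (fun t => expR (t * ln u))); last first.
  by apply/funext => t; rewrite /powR gt_eqF.
move=> t; apply: continuous_cvg; first exact: continuous_expR.
by apply: cvgM; last exact: cvg_cst; exact: cvg_id.
Qed.

Lemma continuous_logmean_integrand u v : 0 < u -> 0 < v ->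
  continuous (fun t => u `^ t * v `^ (1 - t)).
Proof.
move=> u0 v0 t; apply: cvgM; first exact: continuous_powR_exponent.
apply: (@continuous_cvg _ _ _ _ _ _ (fun t => v `^ t)); first exact: continuous_powR_exponent.
by apply: cvgB; [exact: cvg_cst|exact: cvg_id].
Qed.

Lemma logmean_expmoment u v : 0 < u -> 0 < v ->
  logmean u v = v * expmoment 0 (ln u - ln v).
Proof.
move=> u0 v0; rewrite /logmean /expmoment -RintegralZl//; last first.
  exact/continuous_integrable_itv/continuous_expmoment_integrand.
apply: eq_Rintegral => t _; rewrite expr0 mul1r.
rewrite -{2}[v](lnK v0) /powR !gt_eqF// -!expRD; congr expR; ring.
Qed.

Lemma logmean0l v : logmean 0 v = 0.
Proof.
(* At [t = 0] the convention that zero to the power zero is one can keep the integrand from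
   vanishing, so this end point is removed first. *)
rewrite /logmean /Rintegral -integral_itv_obnd_cbnd; last first.
  apply: (eq_measurable_fun (cst 0%E)) => [t|]; last exact: measurable_cst.
  rewrite inE /= in_itv /= => /andP[t0 _].
  by rewrite powR0 ?gt_eqF// mul0r.
rewrite (eq_integral (cst 0%E)) ?integral0// => t.
by rewrite inE /= in_itv /= => /andP[t0 _]; rewrite powR0 ?gt_eqF// mul0r.
Qed.

Lemma logmean0r u : logmean u 0 = 0.
Proof.
rewrite /logmean /Rintegral -integral_itv_bndo_bndc; last first.
  apply: (eq_measurable_fun (cst 0%E)) => [t|]; last exact: measurable_cst.
  rewrite inE /= in_itv /= => /andP[_ t1].
  by rewrite powR0 ?mulr0// gt_eqF// subr_gt0.
rewrite (eq_integral (cst 0%E)) ?integral0// => t.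
by rewrite inE /= in_itv /= => /andP[_ t1]; rewrite powR0 ?mulr0// gt_eqF// subr_gt0.
Qed.

(** The substitution of [1 - t] for [t]. Zero arguments are treated apart because the integrand can
    then be discontinuous. *)
Lemma logmeanC u v : 0 <= u -> 0 <= v -> logmean u v = logmean v u.
Proof.
rewrite le_eqVlt => /predU1P[<-|u0]; first by rewrite logmean0l logmean0r.
rewrite le_eqVlt => /predU1P[<-|v0]; first by rewrite logmean0l logmean0r.
have c : {within `[0, 1 : R], continuous (fun t => u `^ t * v `^ (1 - t))}.
  exact/continuous_subspaceT/continuous_logmean_integrand.
have h01 : 0 <= (1 : R) <= 1 by rewrite ler01 lexx.
apply: (etrans (Rintegration_by_substitution_onem h01 c)).
rewrite {1}/unstable.onem subrr; apply: eq_Rintegral => t _.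
by rewrite mulrC /unstable.onem subKr.
Qed.

Lemma logmean_id u : 0 < u -> logmean u u = u.
Proof.
move=> u0; rewrite logmean_expmoment// subrr /expmoment.
under eq_Rintegral do rewrite expr0 mul1r mulr0 expR0.
by rewrite Rintegral_cst//= lebesgue_measure_itv/= lte_fin ltr01 oppr0 adde0 /= !mulr1.
Qed.

Lemma logmean_le_pos u v u' v' : 0 < u -> 0 < v -> u <= u' -> v <= v' ->
  logmean u v <= logmean u' v'.
Proof.
move=> u0 v0 uu' vv'; apply: le_Rintegral => //.
- exact/continuous_integrable_itv/continuous_logmean_integrand.
- apply/continuous_integrable_itv/continuous_logmean_integrand.
    exact: lt_le_trans uu'.
  exact: lt_le_trans vv'.
- move=> t /=; rewrite in_itv /= => /andP[t0 t1].
  rewrite ler_pM ?powR_ge0//.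
    by rewrite ge0_ler_powR// nnegrE ltW// (lt_le_trans u0).
  by rewrite ge0_ler_powR ?subr_ge0// nnegrE ltW// (lt_le_trans v0).
Qed.

Lemma logmean_ge0 u v : 0 <= logmean u v.
Proof. by apply: Rintegral_ge0 => t _; rewrite mulr_ge0 ?powR_ge0. Qed.

Lemma le_logmean u v u' v' : 0 <= u -> 0 <= v -> u <= u' -> v <= v' ->
  logmean u v <= logmean u' v'.
Proof.
rewrite le_eqVlt => /predU1P[<-|u0]; first by rewrite logmean0l => *; exact: logmean_ge0.
rewrite le_eqVlt => /predU1P[<-|v0]; first by rewrite logmean0r => *; exact: logmean_ge0.
exact: logmean_le_pos.
Qed.

(** By monotonicity the mean is at least [logmean m m = m], with [m] the smaller argument. *)
Lemma logmean_gt0 u v : 0 < u -> 0 < v -> 0 < logmean u v.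
Proof.
move=> u0 v0; have m0 : 0 < Num.min u v by rewrite lt_min u0.
apply: (lt_le_trans m0); rewrite -[leLHS](logmean_id m0).
by apply: le_logmean; rewrite ?ge_min ?lexx ?orbT // ltW.
Qed.

Lemma logmeanZ c u v : 0 < c -> 0 <= u -> 0 <= v ->
  logmean (c * u) (c * v) = c * logmean u v.
Proof.
move=> c0; rewrite le_eqVlt => /predU1P[<-|u0]; first by rewrite mulr0 !logmean0l mulr0.
rewrite le_eqVlt => /predU1P[<-|v0]; first by rewrite mulr0 !logmean0r mulr0.
rewrite !logmean_expmoment ?mulr_gt0// !lnM// -mulrA; congr (_ * (_ * expmoment _ _)); ring.
Qed.

End LogMean.

(** * The tangent decomposition and the metric *)

Local Opaque logmean.

Record reversible_chain {R : realType} {X : finType} (K : X -> X -> R)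
    (varpi p : X -> R) : Prop := ReversibleChain {
  chain_markov : markov_kernel K;
  chain_irreducible : irreducible_kernel K;
  chain_steady : steady_state K varpi;
  chain_reversible : reversible K varpi;
  chain_pos : pos_measures p;
  chain_norm : l1norm varpi p = 1 }.

Section TangentSpace.
Context {R : realType} {X : finType}.
Variables (K : X -> X -> R) (varpi p : X -> R).
Hypothesis chain : reversible_chain K varpi p.
Implicit Types (mu psi phi rho xi : X -> R) (Phi Psi : X -> X -> R).

(** Some point has positive mass because the total is 1, and stationarity passes positivity along
    every edge; irreducibility reaches all points. *)
Lemma steady_state_gt0 x : 0 < varpi x.
Proof.
have [ge0 sum1 statE] := chain_steady chain; have [K0 _] := chain_markov chain.
have [x0 x00] : exists x0, 0 < varpi x0.
  apply/existsP; apply: contraT => /existsPn H.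
  move: sum1; rewrite big1 => [/eqP|y _]; first by rewrite eq_sym oner_eq0.
  by apply/eqP; rewrite eq_le ge0 leNgt H.
have /connectP[s sP ->] := chain_irreducible chain x0 x.
elim: s x0 x00 sP => //= y s IH x0 x00 /andP[Kxy ys]; apply: IH ys.
rewrite statE (bigD1 x0)//= ltr_pwDl ?mulr_gt0// sumr_ge0// => z _.
exact: mulr_ge0.
Qed.

(** On a tangent vector this is the coefficient [h] of its decomposition, whatever the base
    point. *)
Definition wmean psi : R := \sum_x varpi x * psi x.

Lemma wmean_p : wmean p = 1.
Proof.
rewrite -(chain_norm chain) /wmean /l1norm; apply: eq_bigr => x _.
by rewrite ger0_norm// ltW// (chain_pos chain).
Qed.

Lemma edge_meanC mu x y : measures mu -> edge_mean mu x y = edge_mean mu y x.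
Proof. by move=> mu0; exact: logmeanC. Qed.

Lemma edge_mean_ge0 mu x y : 0 <= edge_mean mu x y.
Proof. exact: logmean_ge0. Qed.

Lemma edge_mean_gt0 mu x y : pos_measures mu -> 0 < edge_mean mu x y.
Proof. by move=> mu0; exact: logmean_gt0. Qed.

Lemma pos_measuresW mu : pos_measures mu -> measures mu.
Proof. by move=> mu0 x; exact: ltW. Qed.

(** Detailed balance makes the edge weight [w] symmetric, so the two summation variables can be
    exchanged in the half of the sum that contains [Psi y x]. *)
Lemma ddiv_by_parts mu phi Psi : measures mu ->
  \sum_x varpi x * phi x * ddiv K mu Psi x = - edge_inner K varpi mu (dgrad phi) Psi.
Proof.
move=> mu0; pose w x y := edge_mean mu x y * K x y * varpi x.
have wC x y : w x y = w y x.
  by rewrite /w -!mulrA (chain_reversible chain) edge_meanC.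
transitivity (2^-1 * (\sum_x \sum_y phi x * Psi x y * w x y -
                      \sum_x \sum_y phi x * Psi y x * w x y)).
  rewrite -sumrB mulr_sumr; apply: eq_bigr => x _.
  rewrite -sumrB /ddiv mulrCA; congr (_ * _); rewrite mulr_sumr.
  by apply: eq_bigr => y _; rewrite /w; ring.
rewrite [X in _ - X]exchange_big /= /edge_inner -mulrN; congr (_ * _).
rewrite -sumrB -sumrN; apply: eq_bigr => x _.
rewrite -sumrB -sumrN; apply: eq_bigr => y _.
by rewrite (wC y x) /dgrad /w; ring.
Qed.

Lemma edge_innerC mu Phi Psi :
  edge_inner K varpi mu Phi Psi = edge_inner K varpi mu Psi Phi.
Proof.
by rewrite /edge_inner; congr (_ * _); apply: eq_bigr => x _; apply: eq_bigr => y _; ring.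
Qed.

Lemma edge_term_ge0 mu Psi x y :
  0 <= Psi x y * Psi x y * edge_mean mu x y * K x y * varpi x.
Proof.
have [K0 _] := chain_markov chain; rewrite -expr2.
apply: mulr_ge0; last exact/ltW/steady_state_gt0.
by apply: mulr_ge0 => //; apply: mulr_ge0; rewrite ?sqr_ge0 ?edge_mean_ge0.
Qed.

Lemma edge_inner_ge0 mu Psi : 0 <= edge_inner K varpi mu Psi Psi.
Proof.
rewrite /edge_inner mulr_ge0 ?invr_ge0// sumr_ge0// => x _; rewrite sumr_ge0// => y _.
exact: edge_term_ge0.
Qed.

Lemma ddiv_dgrad mu psi x :
  ddiv K mu (dgrad psi) x = \sum_y (psi y - psi x) * (edge_mean mu x y * K x y).
Proof.
rewrite /ddiv mulr_sumr; apply: eq_bigr => y _; rewrite /dgrad.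
by field.
Qed.

Lemma ddiv_dgradB mu phi psi x :
  ddiv K mu (dgrad (phi \- psi)) x = ddiv K mu (dgrad phi) x - ddiv K mu (dgrad psi) x.
Proof.
by rewrite !ddiv_dgrad -sumrB; apply: eq_bigr => y _ /=; ring.
Qed.

(** Integration by parts against the constant function 1, whose gradient vanishes. *)
Lemma wmean_ddiv mu Psi : measures mu -> wmean (ddiv K mu Psi) = 0.
Proof.
move=> mu0; have := ddiv_by_parts (fun=> 1) Psi mu0.
rewrite /edge_inner [X in _ * X]big1 ?mulr0 ?oppr0 => [E|x _].
  by rewrite -[RHS]E; apply: eq_bigr => x _; rewrite mulr1.
by rewrite big1// => y _; rewrite /dgrad subrr !mul0r.
Qed.

(** All terms of the energy are nonnegative, so each vanishes and [psi] is constant across every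
    edge; irreducibility connects any two points. *)
Lemma edge_inner_eq0_cst mu psi : pos_measures mu ->
  edge_inner K varpi mu (dgrad psi) (dgrad psi) = 0 -> forall x y, psi x = psi y.
Proof.
move=> mu0 /eqP; have [K0 _] := chain_markov chain.
have term0 x y : 0 <= dgrad psi x y * dgrad psi x y * edge_mean mu x y * K x y * varpi x.
  exact: edge_term_ge0.
rewrite mulf_eq0 invr_eq0 pnatr_eq0 /= psumr_eq0 => [/allP H|x _]; last first.
  by rewrite sumr_ge0.
have edge x y : 0 < K x y -> psi x = psi y.
  move=> Kxy; have := H x; rewrite mem_index_enum => /(_ isT); rewrite psumr_eq0//.
  move=> /allP/(_ y); rewrite mem_index_enum => /(_ isT).
  rewrite !mulf_eq0 (gt_eqF Kxy) (gt_eqF (steady_state_gt0 x)).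
  by rewrite (gt_eqF (edge_mean_gt0 _ _ mu0)) !orbF orbb subr_eq0 => /eqP.
move=> x y; have /connectP[s sP ->] := chain_irreducible chain x y.
by elim: s x sP => //= z s IH x /andP[/edge -> /IH].
Qed.

(** The energy of [phi - psi] is, up to sign, its pairing with its own divergence, which is zero. *)
Lemma dgrad_inj_ddiv mu phi psi : pos_measures mu ->
  (forall x, ddiv K mu (dgrad phi) x = ddiv K mu (dgrad psi) x) ->
  forall x y, phi x - psi x = phi y - psi y.
Proof.
move=> mu0 E; apply: (@edge_inner_eq0_cst mu (phi \- psi)) => //.
apply: oppr_inj; rewrite -ddiv_by_parts ?oppr0; last exact: pos_measuresW.
by rewrite big1// => x _; rewrite ddiv_dgradB E subrr mulr0.
Qed.

(* [psi |-> - div_mu grad psi + wmean psi]; the rank-one term makes the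
   Laplacian invertible without changing it on mean-zero functions. *)
Definition laplace_mx mu : 'M[R]_#|X| := \matrix_(i, j)
  ((i == j)%:R * (\sum_z edge_mean mu (enum_val i) z * K (enum_val i) z)
   - edge_mean mu (enum_val i) (enum_val j) * K (enum_val i) (enum_val j)
   + varpi (enum_val j)).

Lemma laplace_mxE mu psi x :
  \sum_j laplace_mx mu (enum_rank x) j * psi (enum_val j) =
  - ddiv K mu (dgrad psi) x + wmean psi.
Proof.
have -> : wmean psi = \sum_(j < #|X|) varpi (enum_val j) * psi (enum_val j).
  by rewrite /wmean (reindex _ (onW_bij _ (@enum_val_bij X))).
rewrite ddiv_dgrad (reindex _ (onW_bij _ (@enum_val_bij X))) /= -sumrN -big_split /=.
under eq_bigr do rewrite mxE enum_rankK mulrDl mulrBl -mulrA.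
rewrite big_split sumrB /= [X in X - _ + _](bigD1 (enum_rank x)) //= eqxx mul1r enum_rankK.
rewrite [X in _ + X - _ + _]big1 => [|j /negPf]; last by rewrite eq_sym => ->; rewrite mul0r.
rewrite addr0 [in X in X - _ + _](reindex _ (onW_bij _ (@enum_val_bij X))) /=.
rewrite mulr_suml -sumrB -big_split /=; apply: eq_bigr => j _; ring.
Qed.

(** For a kernel vector [psi], averaging the equation against [varpi] removes the divergence and
    gives mean zero. Then [psi] is divergence free, hence constant, hence zero. *)
Lemma laplace_mx_unit mu : pos_measures mu -> laplace_mx mu \in unitmx.
Proof.
move=> mu0; rewrite -unitmx_tr -row_free_unit; apply: inj_row_free => v vM.
pose psi x := v ord0 (enum_rank x).
have E x : - ddiv K mu (dgrad psi) x + wmean psi = 0.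
  rewrite -laplace_mxE; transitivity ((v *m (laplace_mx mu)^T) ord0 (enum_rank x)).
    by rewrite mxE; apply: eq_bigr => j _; rewrite [in RHS]mxE /psi enum_valK mulrC.
  by rewrite vM mxE.
have m0 : wmean psi = 0.
  have := wmean_ddiv (dgrad psi) (pos_measuresW mu0).
  have -> : wmean (ddiv K mu (dgrad psi)) = wmean psi.
    rewrite /wmean [in LHS](eq_bigr (fun x => varpi x * wmean psi)) => [|x _].
      by rewrite -mulr_suml; have [_ -> _] := chain_steady chain; rewrite mul1r.
    by have /eqP := E x; rewrite addrC subr_eq0 => /eqP ->.
  by [].
have cst : forall x y, psi x = psi y.
  move=> x y; have := @dgrad_inj_ddiv mu psi (fun=> 0) mu0 _ x y; rewrite !subr0; apply=> z.
  have := E z; rewrite m0 addr0 => /eqP; rewrite oppr_eq0 => /eqP ->.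
  by rewrite ddiv_dgrad big1// => t _; rewrite subrr mul0r.
apply/rowP => j; rewrite mxE.
have : wmean psi = psi (enum_val j).
  rewrite /wmean (eq_bigr (fun x => varpi x * psi (enum_val j))) => [|x _].
    by rewrite -mulr_suml; have [_ -> _] := chain_steady chain; rewrite mul1r.
  by rewrite (cst x (enum_val j)).
by rewrite m0 /psi enum_valK => <-.
Qed.

Definition green mu x y : R := invmx (laplace_mx mu) (enum_rank x) (enum_rank y).

Definition potential mu rho x : R := \sum_y green mu x y * (rho y - wmean rho * p y).

(** The right-hand side [rho - wmean rho * p] has mean zero, hence so has the solution, and the
    rank-one term of the matrix drops out of the equation. *)
Lemma potentialP mu rho x : pos_measures mu ->
  rho x + ddiv K mu (dgrad (potential mu rho)) x = wmean rho * p x.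
Proof.
move=> mu0; pose c : 'cV[R]_#|X| := \col_j (rho (enum_val j) - wmean rho * p (enum_val j)).
have potE j : potential mu rho (enum_val j) = (invmx (laplace_mx mu) *m c) j ord0.
  rewrite /potential mxE (reindex _ (onW_bij _ (@enum_val_bij X))) /=.
  by apply: eq_bigr => i _; rewrite mxE /green !enum_valK.
have L y : - ddiv K mu (dgrad (potential mu rho)) y + wmean (potential mu rho) =
    rho y - wmean rho * p y.
  rewrite -laplace_mxE; under eq_bigr do rewrite potE.
  transitivity ((laplace_mx mu *m (invmx (laplace_mx mu) *m c)) (enum_rank y) ord0).
    by rewrite [RHS]mxE.
  by rewrite mulmxA mulmxV ?laplace_mx_unit// mul1mx mxE enum_rankK.
have m0 : wmean (potential mu rho) = 0.
  have : \sum_y varpi y * (- ddiv K mu (dgrad (potential mu rho)) y +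
      wmean (potential mu rho)) = \sum_y varpi y * (rho y - wmean rho * p y).
    by apply: eq_bigr => y _; rewrite L.
  under eq_bigr do rewrite mulrDr mulrN; rewrite big_split sumrN /=.
  rewrite -/(wmean (ddiv K mu _)) wmean_ddiv ?oppr0 ?add0r; last exact: pos_measuresW.
  rewrite -mulr_suml; have [_ -> _] := chain_steady chain; rewrite mul1r => ->.
  under eq_bigr do rewrite mulrBr mulrCA; rewrite sumrB -mulr_sumr.
  by rewrite -/(wmean p) wmean_p mulr1 subrr.
by have := L x; rewrite m0; lra.
Qed.

Lemma tangent_wmean mu Psi rho h : measures mu ->
  (forall x, rho x + ddiv K mu Psi x = h * p x) -> h = wmean rho.
Proof.
move=> mu0 E; transitivity (wmean (fun x => h * p x)).
  rewrite /wmean; under eq_bigr do rewrite mulrCA.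
  by rewrite -mulr_sumr -/(wmean p) wmean_p mulr1.
rewrite -[RHS]addr0 -(wmean_ddiv Psi mu0) /wmean -big_split /=.
by apply: eq_bigr => x _; rewrite -E mulrDr.
Qed.

(** Whatever pair [xget] selects, its scalar is [wmean rho] and its potential differs from
    [potential mu rho] by a constant, so the gradients agree. *)
Lemma tangent_pairE mu rho : pos_measures mu ->
  tangent_pair K p mu rho = (dgrad (potential mu rho), wmean rho).
Proof.
move=> mu0; rewrite /tangent_pair; case: xgetP => [[Psi h] _ [[psi /= ->] E]|].
  have hE := tangent_wmean (pos_measuresW mu0) E.
  rewrite hE; congr (_, _); apply/funext => x; apply/funext => y.
  have D z : ddiv K mu (dgrad psi) z = ddiv K mu (dgrad (potential mu rho)) z.
    by apply: (@addrI _ (rho z)); rewrite E hE potentialP.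
  by have := dgrad_inj_ddiv mu0 D x y; rewrite /dgrad; lra.
move=> /(_ (dgrad (potential mu rho), wmean rho)); case; split => /=.
  by exists (potential mu rho).
by move=> x; exact: potentialP.
Qed.

Definition kinetic mu psi : R := edge_inner K varpi mu (dgrad psi) (dgrad psi).

(** Integration by parts trades one potential for its data, which removes the edge weights and makes
    linearity in [rho] visible. *)
Lemma edge_inner_potential mu phi rho : pos_measures mu ->
  edge_inner K varpi mu (dgrad phi) (dgrad (potential mu rho)) =
  wmean (fun x => phi x * (rho x - wmean rho * p x)).
Proof.
move=> mu0; apply: oppr_inj; rewrite -ddiv_by_parts; last exact: pos_measuresW.
rewrite /wmean -sumrN; apply: eq_bigr => x _.
have -> : ddiv K mu (dgrad (potential mu rho)) x = - (rho x - wmean rho * p x).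
  by have := potentialP rho x mu0; lra.
by rewrite mulrN mulrA.
Qed.

Variables (a b : R).
Local Notation g := (metric K varpi p a b).

Lemma metricE mu rho xi : pos_measures mu ->
  g mu rho xi = a ^+ 2 * wmean rho * wmean xi + b ^+ 2 *
    wmean (fun x => potential mu rho x * (xi x - wmean xi * p x)).
Proof.
move=> mu0; rewrite /metric /tangent_h /tangent_grad !tangent_pairE//=.
by rewrite edge_inner_potential.
Qed.

Lemma metric_kinetic mu rho : pos_measures mu ->
  g mu rho rho = a ^+ 2 * wmean rho ^+ 2 + b ^+ 2 * kinetic mu (potential mu rho).
Proof.
by move=> mu0; rewrite /metric /tangent_h /tangent_grad !tangent_pairE//= -mulrA -expr2.
Qed.

Lemma metricC mu rho xi : g mu rho xi = g mu xi rho.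
Proof. by rewrite /metric edge_innerC mulrAC. Qed.

Lemma wmean_linear c rho xi :
  wmean (fun x => c * rho x + xi x) = c * wmean rho + wmean xi.
Proof. by rewrite /wmean mulr_sumr -big_split; apply: eq_bigr => x _ /=; ring. Qed.

Lemma metric_linear mu rho c xi xi' : pos_measures mu ->
  g mu rho (fun x => c * xi x + xi' x) = c * g mu rho xi + g mu rho xi'.
Proof.
move=> mu0; rewrite !metricE// wmean_linear.
set A := wmean (fun x => _ * (xi x - _)); set B := wmean (fun x => _ * (xi' x - _)).
set C := wmean (fun x => _ * (c * xi x + xi' x - _)); suff -> : C = c * A + B by ring.
rewrite /A /B -[RHS]wmean_linear; apply: eq_bigr => x _; congr (_ * _); ring.
Qed.

Lemma metric0 mu rho : pos_measures mu -> g mu rho (fun=> 0) = 0.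
Proof.
move=> mu0; have := metric_linear rho (-1) (fun=> 0) (fun=> 0) mu0.
rewrite (_ : (fun _ => _ + _) = (fun=> 0)); last by apply/funext => x; rewrite mulr0 addr0.
lra.
Qed.

(** Expansion in point masses; it lets the form at a fixed measure pass through integrals and
    limits. *)
Lemma metric_linear_sum mu rho (c : X -> R) : pos_measures mu ->
  g mu rho c = \sum_y g mu rho (fun x => (x == y)%:R) * c y.
Proof.
move=> mu0.
have sum0 : forall s : seq X, g mu rho (fun x => \sum_(y <- s) c y * (x == y)%:R) =
    \sum_(y <- s) g mu rho (fun x => (x == y)%:R) * c y.
  elim=> [|y s IH].
    rewrite big_nil -[RHS](metric0 rho mu0); congr (g mu rho _).
    by apply/funext => x; rewrite big_nil.
  rewrite big_cons -IH mulrC -metric_linear//; congr (g mu rho _).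
  by apply/funext => x; rewrite big_cons.
rewrite -sum0; congr (g mu rho _); apply/funext => x.
rewrite (bigD1 x)//= eqxx mulr1 big1 ?addr0// => y /negPf yx.
by rewrite eq_sym yx mulr0.
Qed.

Lemma metricZr mu c rho xi : pos_measures mu ->
  g mu rho (fun x => c * xi x) = c * g mu rho xi.
Proof.
move=> mu0; rewrite -[RHS]addr0 -[X in _ + X](metric0 rho mu0) -metric_linear//.
by congr (g mu rho _); apply/funext => x; rewrite addr0.
Qed.

Lemma metricDr mu rho xi xi' : pos_measures mu ->
  g mu rho (xi \+ xi') = g mu rho xi + g mu rho xi'.
Proof.
move=> mu0; rewrite -[g mu rho xi]mul1r -metric_linear//; congr (g mu rho _).
by apply/funext => x /=; rewrite mul1r.
Qed.

Lemma metricDD mu rho xi : pos_measures mu ->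
  g mu (rho \+ xi) (rho \+ xi) = g mu rho rho + 2 * g mu rho xi + g mu xi xi.
Proof.
move=> mu0; rewrite metricDr// (metricC _ (rho \+ xi) rho) (metricC _ (rho \+ xi) xi).
by rewrite !metricDr// (metricC _ xi rho); ring.
Qed.

Lemma metricZZ mu c rho : pos_measures mu ->
  g mu (fun x => c * rho x) (fun x => c * rho x) = c ^+ 2 * g mu rho rho.
Proof. by move=> mu0; rewrite metricZr// metricC metricZr// mulrA expr2. Qed.

Lemma kinetic_ge0 mu psi : 0 <= kinetic mu psi.
Proof. exact: edge_inner_ge0. Qed.

Lemma metric_ge0 mu rho : pos_measures mu -> 0 <= g mu rho rho.
Proof.
move=> mu0; rewrite metric_kinetic//.
by apply: addr_ge0; apply: mulr_ge0; rewrite ?sqr_ge0 ?kinetic_ge0.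
Qed.

Lemma metric_gt0 mu rho : 0 < a -> 0 < b -> pos_measures mu -> rho <> (fun=> 0) ->
  0 < g mu rho rho.
Proof.
move=> a0 b0 mu0 rho0; rewrite lt_neqAle metric_ge0// andbT eq_sym.
apply/eqP => g0; apply: rho0; apply/funext => x.
move: g0; rewrite metric_kinetic// => /eqP.
rewrite paddr_eq0; last 2 first.
- by apply: mulr_ge0; rewrite sqr_ge0.
- by apply: mulr_ge0; rewrite ?sqr_ge0 ?kinetic_ge0.
have a2 : a ^+ 2 != 0 by rewrite sqrf_eq0 gt_eqF.
have b2 : b ^+ 2 != 0 by rewrite sqrf_eq0 gt_eqF.
rewrite (mulrI_eq0 _ (mulfI a2)) (mulrI_eq0 _ (mulfI b2)) sqrf_eq0.
move=> /andP[/eqP m0 /eqP k0].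
have cst := edge_inner_eq0_cst mu0 k0.
have := potentialP rho x mu0; rewrite m0 mul0r ddiv_dgrad big1 ?addr0// => y _.
by rewrite (cst y x) subrr mul0r.
Qed.

Lemma metric_CauchySchwarz mu rho xi : pos_measures mu ->
  g mu rho xi <= Num.sqrt (g mu rho rho) * Num.sqrt (g mu xi xi).
Proof.
move=> mu0; set A := g mu rho rho; set B := g mu rho xi; set C := g mu xi xi.
have A0 : 0 <= A by exact: metric_ge0.
have C0 : 0 <= C by exact: metric_ge0.
have Q c d : 0 <= c ^+ 2 * A + 2 * c * d * B + d ^+ 2 * C.
  have := metric_ge0 ((fun x => c * rho x) \+ (fun x => d * xi x)) mu0.
  rewrite metricDD// !metricZZ// metricZr// metricC metricZr// metricC -/A -/B -/C.
  lra.
have [B0|/ltW B0] := leP 0 B; last by rewrite (le_trans B0) ?mulr_ge0 ?sqrtr_ge0.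
rewrite -sqrtrM// -[leLHS]ger0_norm// -sqrtr_sqr ler_wsqrtr//.
have [C00|Cn0] := eqVneq C 0.
  (* With [C = 0] the form [Q 1 d] is affine in [d]; if [B] is nonzero this [d] gives it the value
     -1. *)
  have := Q 1 (- (A + 1) / (2 * B)).
  have [->|Bn0] := eqVneq B 0; first by rewrite expr0n mulr_ge0.
  rewrite C00 !mulr0 addr0 expr1n mul1r mulr1 -mulrA (_ : 2 * _ = - (A + 1)); last by field.
  lra.
have CP : 0 < C by rewrite lt_neqAle eq_sym Cn0.
(* This is the minimiser of [Q 1 d] in [d]; it yields the discriminant inequality. *)
have := Q 1 (- B / C); rewrite -(ler_pM2r CP) mul0r.
have -> : (1 ^+ 2 * A + 2 * 1 * (- B / C) * B + (- B / C) ^+ 2 * C) * C = A * C - B ^+ 2.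
  by field.
by rewrite subr_ge0.
Qed.

Lemma sqrt_metricD mu rho xi : pos_measures mu ->
  Num.sqrt (g mu (rho \+ xi) (rho \+ xi)) <=
  Num.sqrt (g mu rho rho) + Num.sqrt (g mu xi xi).
Proof.
move=> mu0; have A0 := metric_ge0 rho mu0; have C0 := metric_ge0 xi mu0.
rewrite -[leRHS]ger0_norm ?addr_ge0 ?sqrtr_ge0// -sqrtr_sqr ler_wsqrtr//.
rewrite metricDD// sqrrD !sqr_sqrtr//.
by have := metric_CauchySchwarz rho xi mu0; lra.
Qed.

(* At [mu0], the field [edge_mean mu / edge_mean mu0 * dgrad psi] has the same
   divergence as [dgrad psi] at [mu], and gradients minimise the action among
   all fields with a given divergence. *)
Lemma metric_transport mu0 mu kappa rho psi h :
  pos_measures mu0 -> measures mu ->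
  (forall x y, edge_mean mu x y <= kappa * edge_mean mu0 x y) ->
  (forall x, rho x + ddiv K mu (dgrad psi) x = h * p x) ->
  g mu0 rho rho <= a ^+ 2 * h ^+ 2 + b ^+ 2 * (kappa * kinetic mu psi).
Proof.
move=> mu00 mu0' le_mean E.
have mu0W := pos_measuresW mu00.
have hE := tangent_wmean mu0' E.
rewrite metric_kinetic// -hE lerD2l ler_wpM2l ?sqr_ge0//.
have [V VE] : exists V : X -> X -> R, forall x y,
    V x y = edge_mean mu x y / edge_mean mu0 x y * dgrad psi x y.
  by exists (fun x y => edge_mean mu x y / edge_mean mu0 x y * dgrad psi x y).
have := fun x => potentialP rho x mu00; move: (potential mu0 rho) => phi phiP.
have divV x : ddiv K mu0 V x = ddiv K mu (dgrad psi) x.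
  rewrite /ddiv; apply: (congr1 (fun z => 2^-1 * z)); apply: eq_bigr => y _; rewrite !VE.
  rewrite (edge_meanC y x mu0') (edge_meanC y x mu0W).
  have := edge_mean_gt0 x y mu00.
  move: (edge_mean mu0 x y) (edge_mean mu x y) (dgrad psi x y) (dgrad psi y x) (K x y).
  by move=> m0 m A B k m00; field; rewrite gt_eqF.
have sameV : edge_inner K varpi mu0 (dgrad phi) V = kinetic mu0 phi.
  apply: oppr_inj; rewrite -!ddiv_by_parts//; apply: eq_bigr => x _; congr (_ * _).
  rewrite divV; apply: (@addrI _ (rho x)).
  exact: (etrans (E x) (etrans (congr1 (fun c => c * p x) hE) (esym (phiP x)))).
apply: (@le_trans _ _ (edge_inner K varpi mu0 V V)).
  (* By [sameV] the field [V - dgrad phi] is orthogonal to [dgrad phi], so its energy is the energy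
     of [V] minus that of [dgrad phi]. *)
  have := edge_inner_ge0 mu0 (fun x y => V x y - dgrad phi x y).
  have -> : edge_inner K varpi mu0 (fun x y => V x y - dgrad phi x y)
      (fun x y => V x y - dgrad phi x y) = edge_inner K varpi mu0 V V
      - 2 * edge_inner K varpi mu0 (dgrad phi) V + kinetic mu0 phi.
    rewrite /kinetic /edge_inner [2 * (_ * _)]mulrCA -mulrBr -mulrDr; congr (_ * _).
    rewrite mulr_sumr -sumrB -big_split; apply: eq_bigr => x _ /=.
    rewrite mulr_sumr -sumrB -big_split; apply: eq_bigr => y _ /=; ring.
  by rewrite sameV; lra.
rewrite /kinetic /edge_inner mulrCA ler_wpM2l ?invr_ge0// mulr_sumr; apply: ler_sum => x _.
rewrite mulr_sumr; apply: ler_sum => y _.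
have m0 := edge_mean_gt0 x y mu00; have [K0 _] := chain_markov chain.
rewrite [leLHS](_ : _ = edge_mean mu x y / edge_mean mu0 x y *
    (dgrad psi x y * dgrad psi x y * edge_mean mu x y * K x y * varpi x)); last first.
  rewrite VE; move: (edge_mean mu0 x y) m0 (edge_mean mu x y) (dgrad psi x y) (K x y).
  by move=> m1 m10 m A k; field; rewrite gt_eqF.
by apply: ler_wpM2r; [exact: edge_term_ge0|rewrite ler_pdivrMr].
Qed.

(** Monotonicity and homogeneity carry the bound on [mu] over to the edge means, so the potential at
    [mu] can be transported to [mu0]. Since [kappa] is at least 1, it may also multiply the [h]
    term. *)
Lemma metric_le_scale mu0 mu kappa rho : 1 <= kappa ->
  pos_measures mu0 -> pos_measures mu -> (forall x, mu x <= kappa * mu0 x) ->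
  g mu0 rho rho <= kappa * g mu rho rho.
Proof.
move=> k1 mu00 mu_0 le_mu; have k0 : 0 < kappa by exact: lt_le_trans k1.
have le_mean x y : edge_mean mu x y <= kappa * edge_mean mu0 x y.
  rewrite /edge_mean -(logmeanZ k0 (ltW (mu00 x)) (ltW (mu00 y))).
  by apply: le_logmean => //; exact: ltW.
apply: (le_trans (metric_transport mu00 (pos_measuresW mu_0) le_mean
  (fun x => potentialP rho x mu_0))).
rewrite (metric_kinetic rho mu_0) mulrDr [kappa * (b ^+ 2 * _)]mulrCA lerD2r.
by rewrite -[leLHS]mul1r; apply: ler_wpM2r => //; apply: mulr_ge0; rewrite sqr_ge0.
Qed.

End TangentSpace.

(** * Smoothness of the metric *)

Section CkCalculus.
Context {R : realType} {V : normedModType R}.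
Variable U : set V.
Hypothesis oU : open U.
Implicit Types (f g : V -> R) (x v : V).

(** The first-order expansion of [f] at [x] is also one of [g], and the differential is determined
    by such an expansion. *)
Lemma near_eq_differentiable f g x : (\forall y \near x, f y = g y) ->
  differentiable f x -> differentiable g x.
Proof.
move=> fg df; have fgx : f x = g x := nbhs_singleton fg.
have [cdf /eqaddoP E] := (diff_locallyP x f).1 df.
have E' : g \o shift x = cst (g x) + 'd f x +o_ 0 id.
  apply/eqaddoP => e e0; have := E e e0; apply: filter_app.
  move: fg; rewrite (near_shift 0) subr0; apply: filterS => h /= fgh.
  by rewrite !fctE /= fgh fgx.
by apply/diff_locallyP; rewrite (diff_unique cdf E').
Qed.

Lemma open_near_eq f g x : (forall y, U y -> f y = g y) -> U x ->
  \forall y \near x, f y = g y.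
Proof. by move=> fg Ux; have := open_nbhs_nbhs (conj oU Ux); apply: filterS. Qed.

(** Used throughout to replace a directional derivative by a formula valid only on [U]; openness
    makes agreement on [U] local agreement. *)
Lemma Ck_on_ext k f g : (forall x, U x -> f x = g x) -> Ck_on k U f -> Ck_on k U g.
Proof.
elim: k f g => [|k IH] f g fg /=.
  move=> cf x Ux; have cfx : f y @[y --> x] --> f x := cf x Ux.
  rewrite (fg x Ux) in cfx; apply: cvg_trans cfx.
  by apply: near_eq_cvg; apply: filterS (open_near_eq fg Ux).
move=> [df Dv]; split=> [x Ux|v].
  by apply: near_eq_differentiable (df _ Ux); exact: open_near_eq.
apply: IH (Dv v) => x Ux.
by apply: near_eq_derive; exact: open_near_eq.
Qed.

Lemma Ck_onS k f : Ck_on k.+1 U f -> Ck_on k U f.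
Proof.
elim: k f => [|k IH] f /= [df Dv]; last by split => // v; exact/IH/Dv.
by move=> x Ux; exact/differentiable_continuous/df.
Qed.

Lemma Ck_on_cst k (c : R) : Ck_on k U (fun=> c).
Proof.
elim: k c => [|k IH] c /=; first by move=> x _; exact: cst_continuous.
split=> [x _|v]; first exact: differentiable_cst.
by apply: Ck_on_ext (IH 0) => x _; rewrite derive_cst.
Qed.

Lemma Ck_onD k f g : Ck_on k U f -> Ck_on k U g -> Ck_on k U (fun x => f x + g x).
Proof.
elim: k f g => [|k IH] f g /=.
  by move=> cf cg x Ux; apply: cvgD; [exact: cf|exact: cg].
move=> [df Df] [dg Dg]; split=> [x Ux|v]; first exact: differentiableD (df _ Ux) (dg _ Ux).
apply: Ck_on_ext (IH _ _ (Df v) (Dg v)) => x Ux.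
by rewrite -deriveD//; apply: diff_derivable; [exact: df|exact: dg].
Qed.

Lemma Ck_onM k f g : Ck_on k U f -> Ck_on k U g -> Ck_on k U (fun x => f x * g x).
Proof.
elim: k f g => [|k IH] f g.
  by move=> /= cf cg x Ux; apply: cvgM; [exact: cf|exact: cg].
move=> Cf Cg; have cf := Ck_onS Cf; have cg := Ck_onS Cg.
move: Cf Cg => [df Df] [dg Dg]; split=> [x Ux|v]; first exact: differentiableM (df _ Ux) (dg _ Ux).
apply: Ck_on_ext (Ck_onD (IH _ _ cf (Dg v)) (IH _ _ cg (Df v))) => x Ux.
by rewrite [RHS]deriveM//; apply: diff_derivable; [exact: df|exact: dg].
Qed.

Lemma Ck_onV k f : (forall x, U x -> f x != 0) -> Ck_on k U f -> Ck_on k U (fun x => (f x)^-1).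
Proof.
move=> f0; elim: k => [|k IH].
  by move=> /= cf x Ux; apply: cvgV; [exact: f0|exact: cf].
move=> Cf; have cf := IH (Ck_onS Cf); move: Cf => [df Df]; split=> [x Ux|v].
  by apply: differentiableV; [exact: df|exact: f0].
apply: Ck_on_ext (Ck_onM (Ck_onM (Ck_on_cst k (-1)) (Ck_onM cf cf)) (Df v)) => x Ux.
rewrite deriveV//; [|exact: f0|exact/diff_derivable/df].
by rewrite mulN1r -exprVn expr2.
Qed.

Lemma derive_comp1 f (h : R -> R) x v (dh : R) : differentiable f x ->
  is_derive (f x) 1 h dh -> 'D_v (h \o f) x = dh * 'D_v f x.
Proof.
move=> df [hd <-]; have dh' : differentiable h (f x) by apply/derivable1_diffP.
rewrite !deriveE//; last exact: differentiable_comp.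
rewrite diff_comp//= mulrC -[X in 'd h _ X]mulr1.
by rewrite -[X in _ = X]/('d f x v *: 'd h (f x) 1) -linearZ.
Qed.

(** A whole sequence of successive derivatives is given, so that the induction on [k] can pass from
    [h n] to [h n.+1]. *)
Lemma Ck_on_comp k (h : nat -> R -> R) f (D : set R) :
  (forall n s, D s -> is_derive s 1 (h n) (h n.+1 s)) ->
  (forall x, U x -> D (f x)) ->
  Ck_on k U f -> forall n, Ck_on k U (fun x => h n (f x)).
Proof.
move=> dh fD; elim: k => [|k IH].
  move=> /= cf n x Ux; apply: (@continuous_cvg _ _ _ _ _ f (h n) (f x)); last exact: cf.
  apply: differentiable_continuous; apply/derivable1_diffP.
  by have [] := dh n _ (fD _ Ux).
move=> Cf n; have cf := IH (Ck_onS Cf); move: Cf => [df Df]; split=> [x Ux|v].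
  apply: differentiable_comp; first exact: df.
  by apply/derivable1_diffP; have [] := dh n _ (fD _ Ux).
apply: Ck_on_ext (Ck_onM (cf n.+1) (Df v)) => x Ux.
by rewrite (derive_comp1 _ (df x Ux) (dh n _ (fD _ Ux))).
Qed.

Lemma Ck_on_ln k f : (forall x, U x -> 0 < f x) -> Ck_on k U f -> Ck_on k U (fun x => ln (f x)).
Proof.
move=> f0; case: k => [|k].
  move=> /= cf x Ux; apply: (@continuous_cvg _ _ _ _ _ f (@ln R) (f x)); last exact: cf.
  exact/continuous_ln/f0.
move=> Cf; have cf := Ck_onS Cf; move: Cf => [df Df]; split=> [x Ux|v].
  apply: differentiable_comp; first exact: df.
  by apply/derivable1_diffP; have [] := is_derive1_ln (f0 _ Ux).
apply: Ck_on_ext (Ck_onM (Ck_onV _ cf) (Df v)) => [x Ux|x Ux]; last by rewrite gt_eqF ?f0.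
by rewrite (derive_comp1 _ (df x Ux) (is_derive1_ln (f0 _ Ux))).
Qed.

Lemma Ck_on_sum k (I : Type) (r : seq I) (P : pred I) (F : I -> V -> R) :
  (forall i, P i -> Ck_on k U (F i)) -> Ck_on k U (fun x => \sum_(i <- r | P i) F i x).
Proof.
move=> CF; elim: r => [|i r IH].
  by apply: Ck_on_ext (Ck_on_cst k 0) => x _; rewrite big_nil.
case: (boolP (P i)) => Pi.
  by apply: Ck_on_ext (Ck_onD (CF _ Pi) IH) => x _; rewrite big_cons Pi.
by apply: Ck_on_ext IH => x _; rewrite big_cons (negPf Pi).
Qed.

Lemma Ck_on_prod k (I : Type) (r : seq I) (P : pred I) (F : I -> V -> R) :
  (forall i, P i -> Ck_on k U (F i)) -> Ck_on k U (fun x => \prod_(i <- r | P i) F i x).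
Proof.
move=> CF; elim: r => [|i r IH].
  by apply: Ck_on_ext (Ck_on_cst k 1) => x _; rewrite big_nil.
case: (boolP (P i)) => Pi.
  by apply: Ck_on_ext (Ck_onM (CF _ Pi) IH) => x _; rewrite big_cons Pi.
by apply: Ck_on_ext IH => x _; rewrite big_cons (negPf Pi).
Qed.

Lemma Ck_on_det k n (M : V -> 'M[R]_n) :
  (forall i j, Ck_on k U (fun x => M x i j)) -> Ck_on k U (fun x => \det (M x)).
Proof.
move=> CM; rewrite /determinant; apply: Ck_on_sum => s _.
by apply: Ck_onM; [exact: Ck_on_cst|apply: Ck_on_prod => i _].
Qed.

(** Cramer's rule: cofactors divided by the determinant, all of them polynomials in the entries. *)
Lemma Ck_on_invmx k n (M : V -> 'M[R]_n) : (forall x, U x -> M x \in unitmx) ->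
  (forall i j, Ck_on k U (fun x => M x i j)) ->
  forall i j, Ck_on k U (fun x => invmx (M x) i j).
Proof.
move=> uM CM i j.
have CV : Ck_on k U (fun x => (\det (M x))^-1 * cofactor (M x) j i).
  apply: Ck_onM.
    apply: Ck_onV; last exact: Ck_on_det.
    by move=> x Ux; have := uM x Ux; rewrite unitmxE unitfE.
  apply: Ck_onM; first exact: Ck_on_cst.
  apply: Ck_on_det => i' j'; apply: Ck_on_ext (CM (lift j i') (lift i j')) => x _.
  by rewrite !mxE.
by apply: Ck_on_ext CV => x Ux; rewrite /invmx uM// !mxE.
Qed.

End CkCalculus.

(** * Smooth dependence of the edge means, the Green matrix and the metric on the base point *)

Section SmoothMetric.
Context {R : realType} {X : finType}.
Variables (K : X -> X -> R) (varpi p : X -> R) (a b : R).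
Hypothesis chain : reversible_chain K varpi p.

Definition pos_rows : set 'rV[R]_#|X| := @fun_of_row R X @^-1` pos_measures.

Lemma open_pos_rows : open pos_rows.
Proof.
rewrite openE => v v0; rewrite /interior /pos_rows.
apply: (@filter_forall _ X (fun x w => 0 < fun_of_row w x) (nbhs v) (nbhs_filter v)) => x.
have c : fun_of_row w x @[w --> v] --> fun_of_row v x by exact: coord_continuous.
by apply: (cvgr_gt _ c); exact: v0.
Qed.

Lemma Ck_on_coord k x : Ck_on k pos_rows (fun v => fun_of_row v x).
Proof.
have D (v w : 'rV[R]_#|X|) : 'D_v (fun u => fun_of_row u x) w = fun_of_row v x.
  have := derive_mx (@derivable_id _ _ w v); rewrite derive_id => /matrixP/(_ ord0 (enum_rank x)).
  by rewrite mxE => <-.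
case: k => [|k] /=.
  by move=> v _; exact: coord_continuous.
split=> [v _|v]; first exact: differentiable_coord.
by apply: (Ck_on_ext open_pos_rows) (Ck_on_cst open_pos_rows k (fun_of_row v x)) => w _; rewrite D.
Qed.

Lemma Ck_on_edge_mean k x y : Ck_on k pos_rows (fun v => edge_mean (fun_of_row v) x y).
Proof.
have o := open_pos_rows.
have ln_coord z : Ck_on k pos_rows (fun v => ln (fun_of_row v z)).
  by apply: Ck_on_ln => //; exact: Ck_on_coord.
have E : Ck_on k pos_rows (fun v => fun_of_row v y *
    expmoment 0 (ln (fun_of_row v x) + (-1) * ln (fun_of_row v y))).
  apply: Ck_onM => //; first exact: Ck_on_coord.
  apply: (@Ck_on_comp _ _ _ o k expmoment _ setT) => //.
    by move=> n s _; exact: is_derive_expmoment.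
  by apply: Ck_onD => //; apply: Ck_onM => //; exact: Ck_on_cst.
apply: Ck_on_ext E => // v v0.
by rewrite /edge_mean logmean_expmoment ?mulN1r//; exact: v0.
Qed.

Lemma Ck_on_green k x y : Ck_on k pos_rows (fun v => green K varpi (fun_of_row v) x y).
Proof.
have o := open_pos_rows.
apply: Ck_on_invmx => // [v v0|i j]; first exact: (laplace_mx_unit chain).
have weight z t : Ck_on k pos_rows (fun v => edge_mean (fun_of_row v) z t * K z t).
  by apply: Ck_onM => //; [exact: Ck_on_edge_mean|exact: Ck_on_cst].
have E : Ck_on k pos_rows (fun v =>
    (i == j)%:R * (\sum_z edge_mean (fun_of_row v) (enum_val i) z * K (enum_val i) z)
    + (-1) * (edge_mean (fun_of_row v) (enum_val i) (enum_val j) * K (enum_val i) (enum_val j))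
    + varpi (enum_val j)).
  apply: Ck_onD => //; last exact: Ck_on_cst.
  apply: Ck_onD => //; apply: Ck_onM => //; try exact: Ck_on_cst.
  by apply: Ck_on_sum => // z _.
by apply: Ck_on_ext E => // v _; rewrite mxE mulN1r.
Qed.

Lemma Ck_on_potential k rho x :
  Ck_on k pos_rows (fun v => potential K varpi p (fun_of_row v) rho x).
Proof.
have o := open_pos_rows; apply: Ck_on_sum => // y _.
by apply: Ck_onM => //; [exact: Ck_on_green|exact: Ck_on_cst].
Qed.

Lemma Ck_on_metric k rho xi :
  Ck_on k pos_rows (fun v => metric K varpi p a b (fun_of_row v) rho xi).
Proof.
have o := open_pos_rows.
have E : Ck_on k pos_rows (fun v => a ^+ 2 * wmean varpi rho * wmean varpi xi + b ^+ 2 *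
    \sum_x varpi x * (potential K varpi p (fun_of_row v) rho x * (xi x - wmean varpi xi * p x))).
  apply: Ck_onD => //; first exact: Ck_on_cst.
  apply: Ck_onM => //; first exact: Ck_on_cst.
  apply: Ck_on_sum => // x _; apply: Ck_onM => //; first exact: Ck_on_cst.
  by apply: Ck_onM => //; [exact: Ck_on_potential|exact: Ck_on_cst].
by apply: Ck_on_ext E => // v v0; rewrite (metricE chain).
Qed.

Lemma metric_smooth_riemannian : 0 < a -> 0 < b ->
  smooth_riemannian_metric (metric K varpi p a b).
Proof.
move=> a0 b0; split; last by move=> rho xi k; exact: Ck_on_metric.
move=> mu mu0; split.
- split=> [xi|rho] c u v.
    rewrite /= (metricC _ _ _ _ _ _ (c *: u + v)) (metricC _ _ _ _ _ _ u) (metricC _ _ _ _ _ _ v).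
    exact: (metric_linear chain).
  exact: (metric_linear chain).
- by move=> rho xi; exact: metricC.
- by move=> rho; exact: (metric_gt0 chain).
Qed.

End SmoothMetric.

(** * The length distance is at most the dynamic distance *)

Section MonotoneIntegral.
Context d (T : measurableType d) (R : realType) (mu : {measure set T -> \bar R}).
Local Open Scope ereal_scope.

(* The integral of a nonnegative function is a supremum over simple functions,
   hence monotone without any measurability; this is what lets integrals of
   [velocity], with its junk values, be compared with measurable ones. *)
Lemma ge0_le_integralW (D : set T) (f g : T -> \bar R) :
  (forall x, D x -> 0 <= f x) -> (forall x, D x -> f x <= g x) ->
  \int[mu]_(x in D) f x <= \int[mu]_(x in D) g x.
Proof.
move=> f0 fg; have g0 x : D x -> 0 <= g x by move=> Dx; exact: le_trans (f0 _ Dx) (fg _ Dx).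
rewrite !ge0_integralE//; apply: le_ereal_sup => _ [h hf <-]; exists h => // x.
apply: le_trans (hf x) _; rewrite /patch; case: ifPn => // /set_mem Dx.
exact: fg.
Qed.

(** Raising [g] to infinity on a measurable null set that contains the exceptional points keeps its
    integral and makes the inequality hold everywhere. *)
Lemma ae_le_integral_measurable_right (D : set T) (f g : T -> \bar R) :
  measurable D -> (forall x, D x -> 0 <= f x) -> measurable_fun D g ->
  (\forall x \ae mu, D x -> f x <= g x) ->
  \int[mu]_(x in D) f x <= \int[mu]_(x in D) g x.
Proof.
move=> mD f0 mg [N [mN N0 fgN]].
pose g' x := if x \in N then +oo else g x.
have mg' : measurable_fun D g'.
  apply: measurable_fun_if => //.
    apply: (measurable_fun_bool true).
    by rewrite preimage_mem_true; exact: measurableI.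
  by apply: measurable_funS mg => // x [].
have -> : \int[mu]_(x in D) g x = \int[mu]_(x in D) g' x.
  apply: ae_eq_integral => //; exists N; split => // x /= gg'.
  apply: contrapT => Nx; apply: gg' => Dx.
  by rewrite /g' memNset.
apply: ge0_le_integralW => // x Dx; rewrite /g'; case: ifPn => [_|/negP xN]; first by rewrite leey.
apply: contrapT => h; apply: xN; apply/mem_set/fgN => /=.
by move=> /(_ Dx).
Qed.

(** Here the measurable [f] is lowered to 0 on the exceptional null set. *)
Lemma ae_le_integral_measurable_left (D : set T) (f g : T -> \bar R) :
  measurable D -> (forall x, D x -> 0 <= g x) -> measurable_fun D f ->
  (\forall x \ae mu, D x -> f x <= g x) -> (forall x, D x -> 0 <= f x) ->
  \int[mu]_(x in D) f x <= \int[mu]_(x in D) g x.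
Proof.
move=> mD g0 mf [N [mN N0 fgN]] f0.
pose f' x := if x \in N then 0 else f x.
have mf' : measurable_fun D f'.
  apply: measurable_fun_if => //.
    apply: (measurable_fun_bool true).
    by rewrite preimage_mem_true; exact: measurableI.
  by apply: measurable_funS mf => // x [].
have -> : \int[mu]_(x in D) f x = \int[mu]_(x in D) f' x.
  apply: ae_eq_integral => //; exists N; split => // x /= ff'.
  apply: contrapT => Nx; apply: ff' => Dx.
  by rewrite /f' memNset.
apply: ge0_le_integralW => x Dx; rewrite /f'.
  by case: ifPn => // _; exact: f0.
case: ifPn => [_|/negP xN]; first exact: g0.
apply: contrapT => h; apply: xN; apply/mem_set/fgN => /=.
by move=> /(_ Dx).
Qed.

End MonotoneIntegral.

(** * Stability of absolute continuity; measurability of the logarithmic mean *)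

Section ACAlgebra.
Context {R : realType}.
Implicit Types (f g : R -> R) (c d k : R).

Lemma lipschitz_abs_continuous c d f k :
  (forall s t, c <= s -> s <= t -> t <= d -> `|f t - f s| <= k * (t - s)) ->
  abs_continuous c d f.
Proof.
move=> lipf e e0; have k0 : 0 < `|k| + 1 by rewrite ltr_wpDl.
exists (e / (`|k| + 1)); first by rewrite divr_gt0.
move=> n s t st _ sumst; apply: (@le_lt_trans _ _ ((`|k| + 1) * \sum_i (t i - s i))).
  rewrite mulr_sumr; apply: ler_sum => i _; have [cs [sti td]] := st i.
  apply: le_trans (lipf _ _ cs sti td) _; apply: ler_wpM2r; first by rewrite subr_ge0.
  by apply: le_trans (ler_norm _) _; rewrite lerDl.
by rewrite mulrC -ltr_pdivlMr.
Qed.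

Lemma abs_continuousD c d f g : abs_continuous c d f -> abs_continuous c d g ->
  abs_continuous c d (fun t => f t + g t).
Proof.
move=> acf acg e e0; have e20 : 0 < e / 2 by rewrite divr_gt0.
have [df df0 Hf] := acf _ e20; have [dg dg0 Hg] := acg _ e20.
exists (Num.min df dg); first by rewrite lt_min df0.
move=> n s t st tri; rewrite lt_min => /andP[/(Hf _ _ _ st tri) hf /(Hg _ _ _ st tri) hg].
rewrite [e]splitr; apply: le_lt_trans (ltrD hf hg).
rewrite -big_split /=; apply: ler_sum => i _.
have -> : f (t i) + g (t i) - (f (s i) + g (s i)) = (f (t i) - f (s i)) + (g (t i) - g (s i)).
  ring.
exact: ler_normD.
Qed.

Lemma abs_continuousZ c d f k : abs_continuous c d f -> abs_continuous c d (fun t => k * f t).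
Proof.
move=> acf e e0; have k0 : 0 < `|k| + 1 by rewrite ltr_wpDl.
have ek : 0 < e / (`|k| + 1) by rewrite divr_gt0.
have [df df0 Hf] := acf _ ek; exists df => // n s t st tri sumst.
apply: (@le_lt_trans _ _ ((`|k| + 1) * \sum_i `|f (t i) - f (s i)|)).
  rewrite mulr_sumr; apply: ler_sum => i _; rewrite -mulrBr normrM.
  by apply: ler_wpM2r => //; rewrite lerDl.
by rewrite mulrC -ltr_pdivlMr//; exact: Hf.
Qed.

Lemma abs_continuous_measurable c d f : c <= d -> abs_continuous c d f ->
  measurable_fun (`[c, d] : set R) f.
Proof.
move=> cd /(abs_continuous_ac_line cd)/ac_line_continuous cf.
apply: (eq_measurable_fun (f \o clamp c d)) => [t|].
  by rewrite inE /= in_itv /= => tcd; rewrite clamp_id.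
by apply: measurable_funTS; exact: continuous_measurable_fun.
Qed.

Lemma continuous_expmoment n : continuous (@expmoment R n).
Proof.
move=> s; apply: differentiable_continuous; apply/derivable1_diffP.
by have [] := is_derive_expmoment n s.
Qed.

Lemma measurable_logmean (D : set R) f g : measurable D ->
  measurable_fun D f -> measurable_fun D g ->
  (forall t, D t -> 0 <= f t) -> (forall t, D t -> 0 <= g t) ->
  measurable_fun D (fun t => logmean (f t) (g t)).
Proof.
(* The indicators supply the value 0 where an argument vanishes; elsewhere the closed formula of
   [logmean_expmoment] applies. *)
move=> mD mf mg f0 g0; pose pos := (\1_(`]0, +oo[ : set R) : R -> R).
have mpos : measurable_fun setT pos by exact: measurable_indic.
apply: (eq_measurable_fun (fun t => pos (f t) * pos (g t) *
    (g t * expmoment 0 (ln (f t) - ln (g t))))) => [t|].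
  have posE s : 0 <= s -> pos s = (s != 0)%:R.
    by move=> s0; rewrite /pos indicE mem_setE in_itv /= andbT lt_neqAle eq_sym s0 andbT.
  rewrite inE => Dt; rewrite !posE ?f0 ?g0//.
  have [->|fn0] := eqVneq (f t) 0; first by rewrite !mul0r logmean0l.
  have [->|gn0] := eqVneq (g t) 0; first by rewrite mulr0 !mul0r logmean0r.
  by rewrite !mul1r logmean_expmoment// lt_neqAle eq_sym ?fn0 ?gn0 ?f0 ?g0.
apply: measurable_funM.
  by apply: measurable_funM; exact: measurableT_comp.
apply: measurable_funM => //.
apply: (measurableT_comp (continuous_measurable_fun (@continuous_expmoment 0))).
by apply: measurable_funB; apply: measurableT_comp => //; exact: measurable_ln.
Qed.

End ACAlgebra.

(** * Length of positive perturbations of admissible curves *)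

Section LengthLeAction.
Context {R : realType} {X : finType}.
Variables (K : X -> X -> R) (varpi p : X -> R) (a b : R).
Hypothesis chain : reversible_chain K varpi p.
Local Notation leb := (@lebesgue_measure R).
Local Notation g := (metric K varpi p a b).
Local Notation kin := (kinetic K varpi).
Implicit Types (mu psi : R -> X -> R) (h : R -> R).

Lemma ac_curve_derivable mu : ac_curve mu -> {ae leb, forall t, t \in `]0, 1[ ->
  forall x, derivable (fun s => mu s x) t 1}.
Proof.
move=> acmu; have aeF : Filter (almost_everywhere leb) by exact: (ae_filter_ringOfSetsType leb).
have H x : {ae leb, forall t, t \in `]0, 1[ -> derivable (fun s => mu s x) t 1}.
  have [phi [_ _]] := abs_continuous_FTC (@ltr01 R) (acmu x).
  by apply: filterS => t Ht t01; have [] := Ht t01.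
by have := filter_forall aeF H; apply: filterS => t Ht t01 x; exact: Ht.
Qed.

Lemma ae_interior : {ae leb, forall t : R, t \in `[0, 1] -> t \in `]0, 1[}.
Proof.
have m1 (z : R) : measurable ([set z] : set (measurableTypeR R)).
  exact: measurable_set1.
exists [set 0; 1]; split; first exact: measurableU.
- apply/eqP; rewrite eq_le measure_ge0 andbT.
  have le01 : (leb ([set 0%R] `|` [set 1%R])%classic <= leb [set 0%R] + leb [set 1%R])%E.
    exact: measureU2.
  by apply: (le_trans le01); rewrite !lebesgue_measure_set1 adde0.
- move=> t /=; rewrite !in_itv /= => H; apply: contrapT => /not_orP[/eqP t0 /eqP t1].
  apply: H => /andP[h0 h1]; by rewrite !lt_neqAle h0 h1 eq_sym t0 t1.
Qed.

Lemma measurable_kinetic (D : set R) mu psi : measurable D ->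
  (forall x, measurable_fun D (fun t => mu t x)) ->
  (forall t, D t -> measures (mu t)) ->
  (forall x, measurable_fun D (fun t => psi t x)) ->
  measurable_fun D (fun t => kin (mu t) (psi t)).
Proof.
move=> mD mmu mu0 mpsi; apply: measurable_funM; first exact: measurable_cst.
apply: measurable_sum => x; apply: measurable_sum => y.
have mgrad : measurable_fun D (fun t => dgrad (psi t) x y) by exact: measurable_funB.
apply: measurable_funM; last exact: measurable_cst.
apply: measurable_funM; last exact: measurable_cst.
apply: measurable_funM; first exact: measurable_funM.
by apply: measurable_logmean => // t /mu0.
Qed.

Lemma positive_lower_bound (f : X -> R) : (forall x, 0 < f x) ->
  exists2 c, 0 < c & forall x, c <= f x.
Proof.
move=> f0; exists (\big[Num.min/1]_x f x); first by apply: lt_bigmin.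
by move=> x; exact: bigmin_le_cond.
Qed.

(** The triangle inequality separates the two velocities. Transporting [psi] from [m] to [nu] costs
    [(1 - d)^-1], which the factor [(1 - d) ^+ 2] absorbs. Comparing [nu] with the constant measure
    [c] costs [d^-1] against [d ^+ 2] and leaves [d]. *)
Lemma perturbed_speed_le (nu m v psi w : X -> R) (h c d : R) :
  0 < d -> d < 1 -> 0 < c -> pos_measures nu -> measures m ->
  (forall x, (1 - d) * m x <= nu x) -> (forall x, d * c <= nu x) ->
  (forall x, v x + ddiv K m (dgrad psi) x = h * p x) ->
  Num.sqrt (g nu (fun x => (1 - d) * v x + d * w x) (fun x => (1 - d) * v x + d * w x)) <=
  Num.sqrt (a ^+ 2 * h ^+ 2 + b ^+ 2 * kin m psi) +
  Num.sqrt (d * g (fun=> c) w w).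
Proof.
move=> d0 d1 c0 nu0 m0 mnu cnu E.
have d10 : 0 < 1 - d by rewrite subr_gt0.
have cpos : pos_measures (fun _ : X => c) by [].
apply: (le_trans (sqrt_metricD chain a b (fun x => (1 - d) * v x) (fun x => d * w x) nu0)).
rewrite (metricZZ chain a b (1 - d) v nu0) (metricZZ chain a b d w nu0).
apply: lerD; apply: ler_wsqrtr.
- have le_mean x y : edge_mean m x y <= (1 - d)^-1 * edge_mean nu x y.
    rewrite ler_pdivlMl// /edge_mean -(logmeanZ d10 (m0 x) (m0 y)).
    by apply: le_logmean => //; apply: mulr_ge0 => //; exact: ltW.
  have T := metric_transport chain a b nu0 m0 le_mean E.
  apply: (@le_trans _ _ ((1 - d) * (a ^+ 2 * h ^+ 2 + b ^+ 2 * ((1 - d)^-1 * kin m psi)))).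
    apply: (@le_trans _ _ ((1 - d) * g nu v v)); last by rewrite ler_pM2l.
    rewrite expr2 -mulrA ler_pM2l// -[leRHS]mul1r ler_wpM2r//.
      exact: (metric_ge0 chain).
    by rewrite gerBl ltW.
  rewrite mulrDr [X in _ + X]mulrCA mulVKf ?gt_eqF// lerD2r -[leRHS]mul1r.
  apply: ler_wpM2r; last by rewrite gerBl ltW.
  by apply: mulr_ge0; rewrite sqr_ge0.
- have : g nu w w <= d^-1 * g (fun=> c) w w.
    apply: (metric_le_scale chain a b) => //.
      by rewrite invf_ge1// ltW.
    by move=> x; rewrite ler_pdivlMl.
  by rewrite -(ler_pM2l (exprn_gt0 2 d0)) mulrA expr2 mulfK// gt_eqF.
Qed.

(** This replaces the Cauchy-Schwarz inequality in time: integrated, with [c] the root of the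
    action, it bounds the integral of the root by that same root. *)
Lemma le_sqrt_AMGM (x c : R) : 0 < c -> 0 <= x -> Num.sqrt x <= 2^-1 * (c^-1 * x + c).
Proof.
move=> c0 x0; set s := Num.sqrt x; have xE : x = s ^+ 2 by rewrite sqr_sqrtr.
rewrite xE ler_pdivlMl// -subr_ge0 (_ : _ - _ = c^-1 * (s - c) ^+ 2).
  by rewrite mulr_ge0 ?sqr_ge0 ?invr_ge0 ?ltW.
by field; rewrite gt_eqF.
Qed.

Lemma action_integral mu psi h :
  measurable_fun (`[0, 1] : set R) h ->
  measurable_fun (`[0, 1] : set R) (fun t => kin (mu t) (psi t)) ->
  action K varpi a b mu psi h =
  (\int[leb]_(t in `[0%R, 1%R]) (a ^+ 2 * h t ^+ 2 + b ^+ 2 * kin (mu t) (psi t))%:E)%E.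
Proof.
move=> mh mk; have mI : measurable (`[0, 1]%classic : set (measurableTypeR R)).
  exact: measurable_itv.
have mh2 : measurable_fun (`[0, 1] : set R) (fun t => (h t ^+ 2)%:E).
  by apply/measurable_EFinP; exact: measurable_funX.
have mkE : measurable_fun (`[0, 1] : set R) (fun t => (kin (mu t) (psi t))%:E).
  exact/measurable_EFinP.
have h20 t : (`[0, 1]%classic : set R) t -> (0 <= (h t ^+ 2)%:E)%E.
  by move=> _; rewrite lee_fin sqr_ge0.
have k0 t : (`[0, 1]%classic : set R) t -> (0 <= (kin (mu t) (psi t))%:E)%E.
  by move=> _; rewrite lee_fin (kinetic_ge0 chain).
have sq0 (z : R) : (0 <= (z ^+ 2)%:E)%E by rewrite lee_fin sqr_ge0.
rewrite /action -(ge0_integralZl leb mI mh2 h20 (sq0 a)).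
rewrite -(ge0_integralZl leb mI mkE k0 (sq0 b)) -ge0_integralD//.
- by move=> t t01; apply: mule_ge0 => //; exact: h20.
- exact: measurable_funeM.
- by move=> t t01; apply: mule_ge0 => //; exact: k0.
- exact: measurable_funeM.
Qed.

Variables (m0 m1 : X -> R).
Hypotheses (m0_pos : pos_measures m0) (m1_pos : pos_measures m1).

Definition perturbed_curve (d : R) mu (t : R) (x : X) : R :=
  (1 - d) * mu t x + d * (m0 x + t * (m1 x - m0 x)).

Lemma perturbed_curve_joining d mu c : 0 < d -> d < 1 ->
  0 < c -> (forall x, c <= m0 x) -> (forall x, c <= m1 x) ->
  ac_curve mu -> (forall t, t \in `[0, 1] -> measures (mu t)) -> mu 0 = m0 -> mu 1 = m1 ->
  joining_curves m0 m1 (perturbed_curve d mu) /\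
  forall t, t \in `[0, 1] -> forall x,
    (1 - d) * mu t x <= perturbed_curve d mu t x /\ d * c <= perturbed_curve d mu t x.
Proof.
move=> d0 d1 c0 cm0 cm1 acmu mu0 mu_0 mu_1.
have lb t x : t \in `[0, 1] -> c <= m0 x + t * (m1 x - m0 x).
  rewrite in_itv /= => /andP[t0 t1].
  have -> : m0 x + t * (m1 x - m0 x) = (1 - t) * m0 x + t * m1 x by ring.
  have -> : c = (1 - t) * c + t * c by ring.
  by apply: lerD; apply: ler_wpM2l => //; rewrite subr_ge0.
have le_curve t x : t \in `[0, 1] ->
    (1 - d) * mu t x <= perturbed_curve d mu t x /\ d * c <= perturbed_curve d mu t x.
  move=> t01; have := lb t x t01 => cle.
  have mux : 0 <= (1 - d) * mu t x by rewrite mulr_ge0 ?subr_ge0 ?(ltW d1)// mu0.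
  have dcle : d * c <= d * (m0 x + t * (m1 x - m0 x)) by rewrite ler_pM2l.
  rewrite /perturbed_curve; split.
    by rewrite lerDl (le_trans _ dcle)// mulr_ge0// ltW.
  by rewrite -[leLHS]add0r lerD.
split; last by move=> t t01 x; exact: le_curve.
split.
- move=> x; rewrite /perturbed_curve.
  apply: abs_continuousD; first exact/abs_continuousZ/acmu.
  apply: abs_continuousZ; apply: (@lipschitz_abs_continuous _ _ _ _ `|m1 x - m0 x|).
  move=> s t _ st _; rewrite opprD addrACA subrr add0r -mulrBl normrM mulrC.
  by rewrite [`|t - s|]ger0_norm ?subr_ge0.
- move=> t t01 x; have [_] := le_curve t x t01.
  by apply: lt_le_trans; rewrite mulr_gt0.
- by apply/funext => x; rewrite /perturbed_curve mu_0; ring.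
- by apply/funext => x; rewrite /perturbed_curve mu_1; ring.
Qed.

Lemma perturbed_velocity d mu t : (forall x, derivable (fun s => mu s x) t 1) ->
  velocity (perturbed_curve d mu) t =
  (fun x => (1 - d) * velocity mu t x + d * (m1 x - m0 x)).
Proof.
move=> dmu; apply/funext => x; rewrite /velocity /perturbed_curve !derive1E.
have dx := derivableP (dmu x).
have lin : is_derive t 1 (fun s : R => m0 x + s * (m1 x - m0 x)) (m1 x - m0 x).
  have -> : (fun s : R => m0 x + s * (m1 x - m0 x)) =
      cst (m0 x) + (m1 x - m0 x) \*: id by apply/funext => s; rewrite !fctE mulrC.
  rewrite -[X in is_derive _ _ _ X]add0r; apply: is_deriveD.
  by rewrite -[X in is_derive _ _ _ X]mulr1; exact: is_deriveZ.
have : is_derive t 1 ((1 - d) \*: (fun s => mu s x) +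
    d \*: (fun s : R => m0 x + s * (m1 x - m0 x)))
    ((1 - d) *: 'D_1 (fun s => mu s x) t + d *: (m1 x - m0 x)).
  by apply: is_deriveD; exact: is_deriveZ.
by move=> /@derive_val.
Qed.

Lemma curve_length_perturbed_le mu psi h d c c' r :
  CE K p m0 m1 mu psi h -> action K varpi a b mu psi h = r%:E ->
  0 < d -> d < 1 -> 0 < c' -> 0 < c -> (forall x, c <= m0 x) -> (forall x, c <= m1 x) ->
  (curve_length g (perturbed_curve d mu) <=
   (2^-1 * (c'^-1 * r + c') +
    Num.sqrt (d * g (fun=> c) (fun x => m1 x - m0 x) (fun x => m1 x - m0 x)))%:E)%E.
Proof.
move=> [acmu mu0 mpsi mh ceq mu_0 mu_1] actE d0 d1 c'0 c0 cm0 cm1.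
set D := Num.sqrt (d * _).
have [_ le_curve] := perturbed_curve_joining d0 d1 c0 cm0 cm1 acmu mu0 mu_0 mu_1.
pose F t := a ^+ 2 * h t ^+ 2 + b ^+ 2 * kin (mu t) (psi t).
have F0 t : 0 <= F t.
  by apply: addr_ge0; apply: mulr_ge0; rewrite ?sqr_ge0 ?(kinetic_ge0 chain).
have mI : measurable (`[0, 1]%classic : set (measurableTypeR R)) by exact: measurable_itv.
have mk : measurable_fun (`[0, 1] : set R) (fun t => kin (mu t) (psi t)).
  apply: measurable_kinetic => //.
  by move=> x; apply: abs_continuous_measurable => //; exact: acmu.
have mF : measurable_fun (`[0, 1] : set R) (fun t => (F t)%:E).
  apply/measurable_EFinP; apply: measurable_funD; apply: measurable_funM => //.
  exact: measurable_funX.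
pose k1 := 2^-1 * c'^-1; pose k2 := 2^-1 * c' + D.
have k10 : (0 <= k1%:E)%E by rewrite lee_fin mulr_ge0// invr_ge0 ltW.
have k20 : (0 <= k2%:E)%E by rewrite lee_fin addr_ge0 ?sqrtr_ge0// mulr_ge0// ltW.
(* The pointwise bound on the speed, arranged so that its integral over [[0, 1]] is the claimed
   constant. *)
pose G t := (k1%:E * (F t)%:E + k2%:E)%E.
have mG : measurable_fun (`[0, 1] : set R) G.
  by apply: emeasurable_funD => //; exact: measurable_funeM.
have -> : (2^-1 * (c'^-1 * r + c') + D)%:E = (\int[leb]_(t in `[0%R, 1%R]) G t)%E.
  rewrite /G ge0_integralD//; last 2 first.
  - by move=> t _; apply: mule_ge0; rewrite // lee_fin.
  - exact: measurable_funeM.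
  rewrite ge0_integralZl//; last by move=> t _; rewrite lee_fin.
  rewrite -action_integral// actE integral_cst//= lebesgue_measure_itv /= lte_fin ltr01.
  by rewrite oppr0 adde0 mule1 -EFinM -EFinD; congr _%:E; rewrite /k1 /k2; ring.
apply: ae_le_integral_measurable_right => //.
have aeF : Filter (almost_everywhere leb) by exact: (ae_filter_ringOfSetsType leb).
move: ae_interior (ac_curve_derivable acmu) ceq; apply: filterS3.
move=> t int der eqn t01.
have {}t01 : t \in `[0, 1] by [].
rewrite (perturbed_velocity d (der (int t01))) /G -EFinM -EFinD lee_fin.
have nu0 : pos_measures (perturbed_curve d mu t).
  by move=> x; have [_] := le_curve t t01 x; apply: lt_le_trans; rewrite mulr_gt0.
have := perturbed_speed_le (v := velocity mu t) (fun x => m1 x - m0 x) d0 d1 c0 nu0 (mu0 _ t01)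
   (fun x => (le_curve t t01 x).1) (fun x => (le_curve t t01 x).2) (eqn t01).
move=> /le_trans; apply; rewrite /k1 /k2 addrA lerD2r.
apply: le_trans (le_sqrt_AMGM c'0 (F0 t)) _.
by rewrite mulrDr mulrA.
Qed.

Lemma length_dist_ge0 : (0 <= length_dist g m0 m1)%E.
Proof.
apply: le_ereal_inf_tmp => _ [mu _ <-]; apply: integral_ge0 => t _.
by rewrite lee_fin sqrtr_ge0.
Qed.

Lemma action_ge0 mu psi h : (0 <= action K varpi a b mu psi h)%E.
Proof.
rewrite adde_ge0// mule_ge0 ?lee_fin ?sqr_ge0// integral_ge0// => t _.
  by rewrite lee_fin sqr_ge0.
by rewrite lee_fin (edge_inner_ge0 chain).
Qed.

Lemma length_dist_le_sqrt_action mu psi h : CE K p m0 m1 mu psi h ->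
  (length_dist g m0 m1 <= sqrte (action K varpi a b mu psi h))%E.
Proof.
move=> ce; have := action_ge0 mu psi h.
case actE : (action K varpi a b mu psi h) => [r| |]//= r0; last by rewrite leey.
rewrite lee_fin in r0.
have [c0 c00 c0m0] := positive_lower_bound m0_pos.
have [c1 c10 c1m1] := positive_lower_bound m1_pos.
pose c := Num.min c0 c1.
have cP : 0 < c by rewrite lt_min c00.
have cm0 x : c <= m0 x by apply: le_trans (c0m0 x); rewrite ge_min lexx.
have cm1 x : c <= m1 x by apply: le_trans (c1m1 x); rewrite ge_min lexx orbT.
set C := g (fun=> c) (fun x => m1 x - m0 x) (fun x => m1 x - m0 x).
have C0 : 0 <= C by exact: (metric_ge0 chain).
have bound c' : 0 < c' -> (length_dist g m0 m1 <= (2^-1 * (c'^-1 * r + c'))%:E)%E.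
  move=> c'0; apply/lee_addgt0Pr => e e0.
  (* Small enough that [d < 1] and [d * C] is at most [e ^+ 2]; the summand 1 avoids a division by
     zero. *)
  pose d := Num.min 2^-1 (e ^+ 2 / (C + 1)).
  have C1 : 0 < C + 1 by rewrite ltr_wpDl.
  have d0 : 0 < d by rewrite lt_min invr_gt0 ltr0n divr_gt0// exprn_gt0.
  have d1 : d < 1 by rewrite gt_min invf_lt1// ltr1n.
  have dC : Num.sqrt (d * C) <= e.
    rewrite -[leRHS]ger0_norm ?(ltW e0)// -sqrtr_sqr; apply: ler_wsqrtr.
    apply: (@le_trans _ _ (d * (C + 1))); first by rewrite ler_pM2l// lerDl.
    by rewrite -ler_pdivlMr// ge_min lexx orbT.
  have [acmu mu0 _ _ _ mu_0 mu_1] := ce.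
  have [joins _] := perturbed_curve_joining d0 d1 cP cm0 cm1 acmu mu0 mu_0 mu_1.
  apply: (@le_trans _ _ (curve_length g (perturbed_curve d mu))).
    by apply: ereal_inf_lbound; exists (perturbed_curve d mu).
  apply: (le_trans (curve_length_perturbed_le ce actE d0 d1 c'0 cP cm0 cm1)).
  by rewrite -EFinD lee_fin lerD2l.
have [r00|rn0] := eqVneq r 0.
  (* With zero action [bound] has no optimal parameter, so [c' = 2 * e] is taken with [e]
     arbitrarily small. *)
  rewrite r00 sqrtr0; apply/lee_addgt0Pr => e e0; rewrite add0e.
  have := bound (2 * e); rewrite r00 mulr0 add0r mulKf//; apply.
  by rewrite mulr_gt0.
have s0 : 0 < Num.sqrt r by rewrite sqrtr_gt0 lt_neqAle eq_sym rn0.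
(* The parameter [c' = Num.sqrt r] minimises the bound. *)
have := bound _ s0; suff -> : 2^-1 * ((Num.sqrt r)^-1 * r + Num.sqrt r) = Num.sqrt r by [].
move: s0 (sqr_sqrtr r0); move: (Num.sqrt r) => s s0 <-.
by field; rewrite gt_eqF.
Qed.

Lemma length_dist_le_dynamic_dist :
  (length_dist g m0 m1 <= dynamic_dist K varpi p a b m0 m1)%E.
Proof.
have L0 := length_dist_ge0.
(* The dynamic distance is the root of an infimum, so the length distance is written as the root of
   its square and the radicands are compared. *)
rewrite -(gee0_abs L0) -sqrte_sqr lee_sqrt.
  apply: le_ereal_inf_tmp => _ [mu [psi [h [ce ->]]]].
  rewrite -[leRHS]sqr_sqrte ?action_ge0// !expe2.
  by apply: lee_pmul => //; exact: length_dist_le_sqrt_action.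
by apply: le_ereal_inf_tmp => _ [mu [psi [h [_ ->]]]]; exact: action_ge0.
Qed.

End LengthLeAction.

(** * The dynamic distance is at most the length distance *)

Lemma continuous_row (R : realType) (n : nat) (f : R -> 'rV[R]_n) :
  (forall j, continuous (fun t => f t ord0 j)) -> continuous f.
Proof.
move=> cf t; apply/cvgrPdist_lt => e e0.
have H : \forall s \near t, forall j, `|f t ord0 j - f s ord0 j| < e.
  apply: (@filter_forall _ 'I_n (fun j s => `|f t ord0 j - f s ord0 j| < e) _ (nbhs_filter t)).
  move=> j; have c : f s ord0 j @[s --> t] --> f t ord0 j by exact: cf.
  by move/cvgrPdist_lt : c; apply.
apply: filterS H => s Hs.
rewrite [ltLHS]mx_normrE; apply: bigmax_lt => // -[i j] _ /=.
by rewrite !mxE (ord1 i); exact: Hs.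
Qed.

(** * Measurability of the metric along a positive curve *)

Section MeasurableMetric.
Context {R : realType} {X : finType}.
Variables (K : X -> X -> R) (varpi p : X -> R) (a b : R).
Hypothesis chain : reversible_chain K varpi p.
Variable m : R -> X -> R.
Hypotheses (acm : ac_curve m) (m_pos : forall t, t \in `[0, 1] -> pos_measures (m t)).
Local Notation I := (`[0, 1]%classic : set R).

(** The curve, extended by [clamp], is a continuous path of positive measures, and the Green matrix
    is continuous on these; the composite is continuous on the whole line. *)
Lemma measurable_green x y : measurable_fun I (fun t => green K varpi (m t) x y).
Proof.
pose r t : 'rV[R]_#|X| := \row_j m (clamp 0 1 t) (enum_val j).
have rE t : fun_of_row (r t) = m (clamp 0 1 t).
  by apply/funext => z; rewrite /fun_of_row mxE enum_rankK.
have cr : continuous r.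
  apply: continuous_row => j.
  have -> : (fun t => r t ord0 j) = (fun t => m t (enum_val j)) \o clamp 0 1.
    by apply/funext => t; rewrite mxE.
  exact/ac_line_continuous/abs_continuous_ac_line/acm.
have rpos t : pos_rows (r t).
  by rewrite /pos_rows /= rE; apply: m_pos; rewrite in_itv /=; exact: clamp_itv.
have cgreen : continuous (fun t => green K varpi (fun_of_row (r t)) x y).
  move=> t; apply: (@continuous_comp _ _ _ r (fun v => green K varpi (fun_of_row v) x y)).
    exact: cr.
  have c0 : forall v, pos_rows v ->
      {for v, continuous (fun v => green K varpi (fun_of_row v) x y)}.
    exact: (Ck_on_green chain 0 x y).
  exact: c0.
apply: (eq_measurable_fun (fun t => green K varpi (fun_of_row (r t)) x y)) => [t|].
  by rewrite inE /= in_itv /= => t01; rewrite rE clamp_id.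
by apply: measurable_funTS; exact: continuous_measurable_fun.
Qed.

Variable rho : R -> X -> R.
Hypothesis mrho : forall x, measurable_fun I (fun t => rho t x).

Lemma measurable_wmean : measurable_fun I (fun t => wmean varpi (rho t)).
Proof. by apply: measurable_sum => x; apply: measurable_funM. Qed.

Lemma measurable_potential x :
  measurable_fun I (fun t => potential K varpi p (m t) (rho t) x).
Proof.
apply: measurable_sum => y; apply: measurable_funM; first exact: measurable_green.
apply: measurable_funB => //; apply: measurable_funM => //; exact: measurable_wmean.
Qed.

Lemma measurable_metric :
  measurable_fun I (fun t => metric K varpi p a b (m t) (rho t) (rho t)).
Proof.
apply: (eq_measurable_fun (fun t => a ^+ 2 * wmean varpi (rho t) ^+ 2 +
    b ^+ 2 * kinetic K varpi (m t) (potential K varpi p (m t) (rho t)))) => [t|].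
  rewrite inE => t01; rewrite (metric_kinetic chain a b (rho t) (m_pos t01)) //.
apply: measurable_funD; apply: measurable_funM => //.
  by apply: measurable_funX; exact: measurable_wmean.
apply: measurable_kinetic => //.
- by move=> x; apply: abs_continuous_measurable => //; exact: acm.
- by move=> t t01 x; apply/ltW/m_pos.
- exact: measurable_potential.
Qed.

End MeasurableMetric.

(** * Integrability and integrals of real-valued combinations *)

Section RealIntegrable.
Context d (T : measurableType d) (R : realType) (mu : {measure set T -> \bar R}).
Variables (D : set T) (mD : measurable D).
Implicit Types (f g : T -> R).

Lemma integrable_addr f g : mu.-integrable D (EFin \o f) -> mu.-integrable D (EFin \o g) ->
  mu.-integrable D (EFin \o (fun t => f t + g t)).
Proof.
by move=> If Ig; rewrite /comp; under eq_fun do rewrite EFinD; exact: integrableD.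
Qed.

Lemma integrable_mulr k f : mu.-integrable D (EFin \o f) ->
  mu.-integrable D (EFin \o (fun t => k * f t)).
Proof.
by move=> If; rewrite /comp; under eq_fun do rewrite EFinM; exact: integrableZl.
Qed.

Lemma integrable_absr f : mu.-integrable D (EFin \o f) ->
  mu.-integrable D (EFin \o (fun t => `|f t|)).
Proof. by move=> If; have := integrable_abse If. Qed.

Lemma integrable_sumr (J : Type) (s : seq J) (f : J -> T -> R) :
  (forall j, mu.-integrable D (EFin \o f j)) ->
  mu.-integrable D (EFin \o (fun t => \sum_(j <- s) f j t)).
Proof.
move=> If; rewrite /comp; under eq_fun do rewrite -sumEFin.
by apply: integrable_sum => // j _; exact: If.
Qed.

Lemma Rintegral_sumr (J : Type) (s : seq J) (f : J -> T -> R) :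
  (forall j, mu.-integrable D (EFin \o f j)) ->
  \int[mu]_(t in D) (\sum_(j <- s) f j t) = \sum_(j <- s) \int[mu]_(t in D) f j t.
Proof.
move=> If; elim: s => [|j s IH].
  by under eq_Rintegral do rewrite big_nil; rewrite big_nil Rintegral_cst// mul0r.
rewrite big_cons -IH -RintegralD//; last exact: integrable_sumr.
by apply: eq_Rintegral => t _; rewrite big_cons.
Qed.

End RealIntegrable.

(** * Reparametrisation by modified arc length *)

Section Reparametrisation.
Context {R : realType} {X : finType}.
Variables (K : X -> X -> R) (varpi p : X -> R) (a b : R).
Hypothesis chain : reversible_chain K varpi p.
Local Notation leb := (@lebesgue_measure R).
Local Notation g := (metric K varpi p a b).
Local Notation I := (`[0, 1]%classic : set R).

Variables (gam : R -> X -> R) (phi : X -> R -> R) (eps : R).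
Hypotheses (ac_gam : ac_curve gam) (gam_pos : forall t, t \in `[0, 1] -> pos_measures (gam t)).
Hypothesis int_phi : forall x, leb.-integrable setT (EFin \o phi x).
Hypothesis gamE : forall x s t, 0 <= s -> s <= t -> t <= 1 ->
  gam t x - gam s x = \int[leb]_(r in `]s, t]) phi x r.
Hypothesis eps_gt0 : 0 < eps.

(** Built from the integrable densities [phi] instead of [velocity], so that measurability is
    available. *)
Definition speed t := Num.sqrt (g (gam t) (phi^~ t) (phi^~ t)).

Hypothesis int_speed : leb.-integrable I (EFin \o speed).

(* The correction term keeps the reparametrised curve Lipschitz and the
   reparametrisation strictly increasing. *)
Definition mod_speed t := speed t + eps * (1 + \sum_x `|phi x t|).

Definition arc_length t := \int[leb]_(r in `[0, t]) mod_speed r.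

Lemma integrable_mod_speed : leb.-integrable I (EFin \o mod_speed).
Proof.
have mI : measurable (I : set (measurableTypeR R)) by exact: measurable_itv.
apply: integrable_addr => //; apply: integrable_mulr => //; apply: integrable_addr => //.
  by apply: continuous_integrable_itv => t; exact: cst_continuous.
apply: integrable_sumr => // x; apply: integrable_absr.
exact: integrableS (int_phi x).
Qed.

Lemma integrable_sub_itv (f : R -> R) s t : 0 <= s -> t <= 1 ->
  leb.-integrable I (EFin \o f) -> leb.-integrable `]s, t] (EFin \o f).
Proof.
move=> s0 t1; apply: integrableS => // r /=.
by rewrite !in_itv /= => /andP[/(le_lt_trans s0)/ltW -> /le_trans ->].
Qed.

Lemma arc_length_sub s t : 0 <= s -> s <= t -> t <= 1 ->
  arc_length t - arc_length s = \int[leb]_(r in `]s, t]) mod_speed r.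
Proof.
move=> s0 st t1; rewrite /arc_length.
apply: (@Rintegral_itvB _ _ (BLeft 0) (BRight t)); rewrite ?bnd_simp//.
apply: integrableS integrable_mod_speed => // r /=.
by rewrite !in_itv /= => /andP[-> /le_trans ->].
Qed.

(** The constant [eps] inside [mod_speed] gives this alone; it makes any inverse of [arc_length]
    monotone and Lipschitz. *)
Lemma arc_length_ge s t : 0 <= s -> s <= t -> t <= 1 ->
  eps * (t - s) <= arc_length t - arc_length s.
Proof.
move=> s0 st t1; rewrite arc_length_sub//.
have -> : eps * (t - s) = \int[leb]_(r in `]s, t]) eps.
  rewrite Rintegral_cst//= lebesgue_measure_itv /= lte_fin; congr (_ * _).
  by case: ltgtP st => [_ _| |-> _] //=; rewrite subrr.
apply: le_Rintegral => //.
- by apply: integrable_sub_itv => //; apply: continuous_integrable_itv => ?; exact: cst_continuous.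
- exact: integrable_sub_itv integrable_mod_speed.
- move=> r _; rewrite /mod_speed -[leLHS]add0r -[X in 0 + X]mulr1 lerD ?sqrtr_ge0//.
  by rewrite ler_pM2l// lerDl sumr_ge0.
Qed.

(** The summand [eps * |phi x|] of [mod_speed] already dominates the increment in the coordinate
    [x]. *)
Lemma gam_dist_le x s t : 0 <= s -> s <= t -> t <= 1 ->
  `|gam t x - gam s x| <= eps^-1 * (arc_length t - arc_length s).
Proof.
move=> s0 st t1; rewrite gamE// arc_length_sub// -RintegralZl//; last first.
  exact: integrable_sub_itv integrable_mod_speed.
have ip : leb.-integrable `]s, t] (EFin \o phi x) by exact: integrableS (int_phi x).
apply: le_trans (le_normr_Rintegral _ ip) _ => //.
apply: le_Rintegral => //.
- exact: integrable_absr.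
- by apply: integrable_mulr => //; exact: integrable_sub_itv integrable_mod_speed.
- move=> r _; rewrite ler_pdivlMl// /mod_speed (bigD1 x)//=.
  have h1 : 0 <= speed r by exact: sqrtr_ge0.
  have h2 : 0 <= \sum_(y | y != x) `|phi y r| by exact: sumr_ge0.
  rewrite -[leLHS]add0r lerD// ler_pM2l// [leRHS]addrCA lerDl.
  by rewrite addr_ge0.
Qed.

(** The norm of an integral is at most the integral of the norms: at the fixed form [g m], pairing
    the increment [D] with itself puts [phi] under the integral, Cauchy-Schwarz bounds the integrand
    by [q] times the norm of [phi], and [q] cancels. The factor [kappa] compares [g m] with the
    metrics along the curve. *)
Lemma metric_increment_le m kappa l u : 0 <= l -> l <= u -> u <= 1 ->
  pos_measures m -> 1 <= kappa ->
  (forall t x, l <= t -> t <= u -> gam t x <= kappa * m x) ->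
  g m (fun x => gam u x - gam l x) (fun x => gam u x - gam l x) <=
  kappa * (arc_length u - arc_length l) ^+ 2.
Proof.
move=> l0 lu u1 m0 k1 le_m; set D := fun x => gam u x - gam l x.
set W := arc_length u - arc_length l; set q := Num.sqrt (g m D D).
have g0 : 0 <= g m D D by exact: (metric_ge0 chain).
have W0 : 0 <= W.
  by apply: le_trans (arc_length_ge l0 lu u1); rewrite mulr_ge0 ?subr_ge0// ltW.
have k0 : 0 < kappa by exact: lt_le_trans k1.
suff qW : q <= Num.sqrt kappa * W.
  rewrite -[leLHS](sqr_sqrtr g0) -/q -(sqr_sqrtr (ltW k0)) -exprMn.
  by rewrite lerXn2r// nnegrE ?sqrtr_ge0// mulr_ge0 ?sqrtr_ge0.
have [q0|qn0] := eqVneq q 0; first by rewrite q0 mulr_ge0 ?sqrtr_ge0.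
have qP : 0 < q by rewrite lt_neqAle eq_sym qn0 sqrtr_ge0.
rewrite -(ler_pM2l qP) -expr2 sqr_sqrtr//.
pose c y := g m D (fun x => (x == y)%:R).
have ip y : leb.-integrable `]l, u] (EFin \o phi y) by exact: integrableS (int_phi y).
have icp y : leb.-integrable `]l, u] (EFin \o (fun r => c y * phi y r)).
  exact: integrable_mulr.
have isum : leb.-integrable `]l, u] (EFin \o (fun r => \sum_y c y * phi y r)).
  exact: integrable_sumr.
have gE (rho : X -> R) : g m D rho = \sum_y c y * rho y.
  exact: (metric_linear_sum chain).
have -> : g m D D = \int[leb]_(r in `]l, u]) \sum_y c y * phi y r.
  by rewrite gE Rintegral_sumr//; apply: eq_bigr => y _; rewrite /D gamE// -RintegralZl.
have -> : q * (Num.sqrt kappa * W) =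
    \int[leb]_(r in `]l, u]) (q * Num.sqrt kappa * mod_speed r).
  by rewrite RintegralZl ?mulrA -?arc_length_sub//; exact: integrable_sub_itv integrable_mod_speed.
apply: le_Rintegral => //.
  by apply: integrable_mulr => //; exact: integrable_sub_itv integrable_mod_speed.
move=> r /=; rewrite in_itv /= => /andP[lr ru]; rewrite -gE.
have r01 : r \in `[0, 1] by rewrite in_itv /= (le_trans l0 (ltW lr)) (le_trans ru u1).
apply: le_trans (metric_CauchySchwarz chain a b _ _ m0) _.
rewrite -/q -mulrA ler_pM2l//.
apply: (@le_trans _ _ (Num.sqrt kappa * speed r)).
  rewrite -(sqrtrM _ (ltW k0)); apply: ler_wsqrtr.
  apply: (metric_le_scale chain a b) => //; first exact: gam_pos.
  by move=> x; apply: le_m => //; exact: ltW.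
apply: ler_wpM2l; first exact: sqrtr_ge0.
by rewrite lerDl mulr_ge0 ?ltW// ltr_wpDr// sumr_ge0.
Qed.

Local Notation Z := (arc_length 1).

Lemma arc_length0 : arc_length 0 = 0.
Proof. by rewrite /arc_length set_itv1 Rintegral_set1. Qed.

Lemma arc_length1_gt0 : 0 < Z.
Proof.
have := arc_length_ge (lexx 0) (@ler01 R) (lexx 1).
by rewrite arc_length0 !subr0 mulr1; exact: lt_le_trans.
Qed.

Lemma arc_length_inverse : exists sig : R -> R, forall s, s \in `[0, 1] ->
  sig s \in `[0, 1] /\ arc_length (sig s) = s * Z.
Proof.
suff /choice[sig sigP] : forall s, exists t, s \in `[0, 1] ->
    t \in `[0, 1] /\ arc_length t = s * Z by exists sig.
move=> s; have [s01|] := boolP (s \in `[0, 1]); last by exists 0.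
have Z0 := arc_length1_gt0; move: (s01); rewrite in_itv /= => /andP[s0 s1].
have [||t t01 tE] := @IVT R arc_length 0 1 (s * Z) ler01.
- exact: (parameterized_integral_continuous ler01 integrable_mod_speed).
- rewrite arc_length0 (min_idPl (ltW Z0)) (max_idPr (ltW Z0)).
  by rewrite mulr_ge0 ?(ltW Z0)//= ler_piMl// ltW.
- by exists t.
Qed.

Lemma gam_le_near (t0 kappa : R) : t0 \in `[0, 1] -> 1 < kappa ->
  exists2 r, 0 < r & forall t, t \in `[0, 1] -> `|t0 - t| < r ->
    forall x, gam t x <= kappa * gam t0 x.
Proof.
move=> t01 k1.
have tE : clamp 0 1 t0 = t0 by apply: clamp_id; move: t01; rewrite in_itv.
have N : \forall t \near t0, forall x, gam (clamp 0 1 t) x < kappa * gam t0 x.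
  apply: (@filter_forall _ X (fun x t => gam (clamp 0 1 t) x < kappa * gam t0 x) _
    (nbhs_filter t0)) => x.
  have c : ((fun s => gam s x) \o clamp 0 1) t @[t --> t0] --> gam t0 x.
    rewrite -[X in _ --> gam X x]tE.
    exact: (ac_line_continuous (abs_continuous_ac_line ler01 (ac_gam x))).
  apply: (cvgr_lt _ c); rewrite ltr_pMl//; exact: gam_pos.
have [r r0 rN] := (nbhs_ballP _ _).1 N.
exists r => // t tI tr x; have := rN t tr x.
by rewrite clamp_id; [exact: ltW|move: tI; rewrite in_itv].
Qed.

Variable sig : R -> R.
Hypothesis sigP : forall s, s \in `[0, 1] -> sig s \in `[0, 1] /\ arc_length (sig s) = s * Z.

Lemma sig_itv s : s \in `[0, 1] -> 0 <= sig s <= 1.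
Proof. by move=> /sigP[]; rewrite in_itv. Qed.

Lemma sig_homo s s' : s \in `[0, 1] -> s' \in `[0, 1] -> s <= s' -> sig s <= sig s'.
Proof.
move=> sI s'I ss'; rewrite leNgt; apply/negP => lt_sig.
have /andP[_ s1] := sig_itv sI; have /andP[s0' _] := sig_itv s'I.
have := arc_length_ge s0' (ltW lt_sig) s1.
have [_ ->] := sigP sI; have [_ ->] := sigP s'I; rewrite -mulrBl.
have : 0 < eps * (sig s - sig s') by rewrite mulr_gt0 ?subr_gt0.
move=> /lt_le_trans h /h; rewrite pmulr_lgt0 ?arc_length1_gt0// subr_gt0.
by rewrite ltNge ss'.
Qed.

Lemma sig_lipschitz s s' : s \in `[0, 1] -> s' \in `[0, 1] -> s <= s' ->
  sig s' - sig s <= eps^-1 * Z * (s' - s).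
Proof.
move=> sI s'I ss'; have /andP[s0 _] := sig_itv sI; have /andP[_ s1'] := sig_itv s'I.
have := arc_length_ge s0 (sig_homo sI s'I ss') s1'.
have [_ ->] := sigP sI; have [_ ->] := sigP s'I; rewrite -mulrBl.
by rewrite -ler_pdivlMl// -mulrA [Z * _]mulrC.
Qed.

Lemma sig0 : sig 0 = 0.
Proof.
have z01 : (0 : R) \in `[0, 1] by rewrite in_itv /= lexx ler01.
have /andP[s0 s1] := sig_itv z01; have := arc_length_ge (lexx 0) s0 s1.
have [_ ->] := sigP z01; rewrite arc_length0 mul0r !subr0 pmulr_rle0// => s0'.
by apply/eqP; rewrite eq_le s0 s0'.
Qed.

Lemma sig1 : sig 1 = 1.
Proof.
have z01 : (1 : R) \in `[0, 1] by rewrite in_itv /= lexx ler01.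
have /andP[s0 s1] := sig_itv z01; have := arc_length_ge s0 s1 (lexx 1).
have [_ ->] := sigP z01; rewrite mul1r subrr pmulr_rle0// subr_le0 => s1'.
by apply/eqP; rewrite eq_le s1 s1'.
Qed.

Definition reparam s := gam (sig s).

Lemma reparam_pos s : s \in `[0, 1] -> pos_measures (reparam s).
Proof. by move=> /sigP[sI _]; exact: gam_pos. Qed.

Lemma ac_reparam : ac_curve reparam.
Proof.
move=> x; apply: (@lipschitz_abs_continuous _ _ _ _ (eps^-1 * Z)) => s t s0 st t1.
have sI : s \in `[0, 1] by rewrite in_itv /= s0 (le_trans st).
have tI : t \in `[0, 1] by rewrite in_itv /= t1 (le_trans s0).
have /andP[sig0s _] := sig_itv sI; have /andP[_ sigt1] := sig_itv tI.
apply: le_trans (gam_dist_le x sig0s (sig_homo sI tI st) sigt1) _.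
have [_ ->] := sigP sI; have [_ ->] := sigP tI.
by rewrite -mulrBl -mulrA [Z * _]mulrC.
Qed.

(** Near [sig s0] the measures along [gam] are at most [kappa] times [reparam s0], so
    [metric_increment_le] applies; the arc length between the two times is exactly [Z] times the
    parameter difference. *)
Lemma reparam_increment_le (s0 kappa : R) : s0 \in `]0, 1[ -> 1 < kappa ->
  \forall s \near s0,
    g (reparam s0) (fun x => reparam s x - reparam s0 x) (fun x => reparam s x - reparam s0 x)
    <= kappa * (Z * (s - s0)) ^+ 2.
Proof.
move=> s0oo k1; have s0I : s0 \in `[0, 1] by exact: subset_itv_oo_cc.
have [sI0 _] := sigP s0I.
have [r r0 near_r] := gam_le_near sI0 k1.
have c0 : 0 < eps^-1 * Z by rewrite mulr_gt0 ?invr_gt0 ?arc_length1_gt0.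
near=> s.
have sI : s \in `[0, 1].
  by apply: subset_itv_oo_cc; near: s; exact: near_in_itvoo.
(* Through the Lipschitz bound on [sig] this keeps [sig s] within [r] of [sig s0]. *)
have ds : `|s0 - s| < r / (eps^-1 * Z).
  by near: s; apply: cvgr_dist_lt => //; rewrite divr_gt0.
have [sIs sE] := sigP sI; have [_ s0E] := sigP s0I.
have pos0 := reparam_pos s0I.
have within t : t \in `[0, 1] -> `|sig s0 - t| <= `|sig s0 - sig s| ->
    forall x, gam t x <= kappa * reparam s0 x.
  move=> tI le_t; apply: near_r => //; apply: (le_lt_trans le_t).
  rewrite ltr_pdivlMr// mulrC in ds; apply: le_lt_trans ds.
  have [ss0|s0s] := leP s s0.
    rewrite !ger0_norm ?subr_ge0 ?sig_homo//; exact: sig_lipschitz.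
  rewrite distrC [`|s0 - s|]distrC !ger0_norm ?subr_ge0 ?sig_homo ?(ltW s0s)//.
  exact/sig_lipschitz/ltW.
move: sI0 sIs; rewrite !in_itv /= => /andP[a0 a1] /andP[b0 b1].
(* The base measure sits at the right end of the time interval when [s <= s0], which reverses the
   increment, and at the left end otherwise. *)
have [ss0|s0s] := leP s s0.
  have h := sig_homo sI s0I ss0.
  have H t x : sig s <= t -> t <= sig s0 -> gam t x <= kappa * reparam s0 x.
    move=> st ts0; apply: within; first by rewrite in_itv /= (le_trans b0 st) (le_trans ts0).
    by rewrite !ger0_norm ?subr_ge0// lerD2l lerN2.
  have := metric_increment_le b0 h a1 pos0 (ltW k1) H.
  rewrite sE s0E -mulrBl (_ : (s0 - s) * Z = - (Z * (s - s0))); last by ring.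
  rewrite sqrrN; apply: le_trans.
  rewrite (_ : (fun x => reparam s x - reparam s0 x) =
      (fun x => -1 * (gam (sig s0) x - gam (sig s) x))); last first.
    by apply/funext => x; rewrite mulN1r opprB.
  by rewrite (metricZZ chain)// sqrrN expr1n mul1r.
have h := sig_homo s0I sI (ltW s0s).
have := metric_increment_le a0 h b1 pos0 (ltW k1) _.
rewrite sE s0E -mulrBl [(s - s0) * Z]mulrC; apply.
move=> t x s0t ts; apply: within; first by rewrite in_itv /= (le_trans a0 s0t) (le_trans ts).
by rewrite distrC [leRHS]distrC !ger0_norm ?subr_ge0// lerD2r.
Unshelve. all: by end_near. Qed.

(** The increment bound divided by the squared step passes to the limit, the form at [reparam s0]
    being continuous. The excess [e] fixes [kappa] through [kappa * Z ^+ 2 = Z ^+ 2 + e]. *)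
Lemma reparam_speed_le (s0 : R) (chi : X -> R) : s0 \in `]0, 1[ ->
  (forall x, is_derive s0 1 (fun s => reparam s x) (chi x)) ->
  g (reparam s0) chi chi <= Z ^+ 2.
Proof.
move=> s0oo dchi; have s0I : s0 \in `[0, 1] by exact: subset_itv_oo_cc.
have m0 := reparam_pos s0I; have Z0 := arc_length1_gt0.
set m := reparam s0 in m0 *.
pose q x h := h^-1 *: (((fun s => reparam s x) \o shift s0) (h *: 1) - reparam s0 x).
have cq x : q x h @[h --> 0^'] --> chi x.
  by have [dx <-] := dchi x; exact: dx.
pose c x y := g m (fun z => (z == x)%:R) (fun z => (z == y)%:R).
have gE (rho : X -> R) : g m rho rho = \sum_y (\sum_x c y x * rho x) * rho y.
  rewrite (metric_linear_sum chain)//; apply: eq_bigr => y _; congr (_ * _).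
  by rewrite metricC (metric_linear_sum chain).
have cg : g m (q^~ h) (q^~ h) @[h --> 0^'] --> g m chi chi.
  rewrite gE; under eq_fun do rewrite gE.
  apply: cvg_big => [|y _]; first exact: add_continuous.
  apply: cvgM => //; apply: cvg_big => [|x _]; first exact: add_continuous.
  by apply: cvgM => //; exact: cvg_cst.
apply/ler_addgt0Pr => e e0.
have k1 : 1 < 1 + e / Z ^+ 2 by rewrite ltrDl divr_gt0// exprn_gt0.
have -> : Z ^+ 2 + e = (1 + e / Z ^+ 2) * Z ^+ 2.
  by rewrite mulrDl mul1r divfK// expf_neq0// gt_eqF.
apply: cvgr_to_le cg _.
have := reparam_increment_le s0oo k1; rewrite (near_shift 0) subr0 => N.
rewrite near_withinE; apply: filterS N => h /= Hh hn0.
have qE : q^~ h = (fun x => h^-1 * (reparam (h + s0) x - m x)).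
  by apply/funext => x; rewrite /q /= [h *: 1]mulr1.
rewrite qE (metricZZ chain)// exprVn ler_pdivrMl; last by rewrite exprn_even_gt0.
by apply: (le_trans Hh); rewrite addrK exprMn [leRHS]mulrCA [h ^+ 2 * _]mulrC.
Qed.

Lemma dynamic_dist_le_arc_length :
  (dynamic_dist K varpi p a b (gam 0%R) (gam 1%R) <= Z%:E)%E.
Proof.
have Z0 := arc_length1_gt0.
(* The densities [chi] are measurable and agree a.e. with the velocity, so they yield measurable
   [psi] and [h]. *)
have /choice[chi chiP] : forall x, exists chi : R -> R,
    leb.-integrable setT (EFin \o chi) /\
    {ae leb, forall t : R, t \in `]0, 1[ -> is_derive t 1 (fun s => reparam s x) (chi t)}.
  by move=> x; have [f [f1 _ f2]] := abs_continuous_FTC (@ltr01 R) (ac_reparam x); exists f.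
pose psi s := potential K varpi p (reparam s) (chi^~ s).
pose h s := wmean varpi (chi^~ s).
have mI : measurable (I : set (measurableTypeR R)) by exact: measurable_itv.
have mchi x : measurable_fun I (chi x).
  apply: measurable_funTS; have [/integrableP[/measurable_EFinP]] := chiP x.
  by [].
have mpsi x : measurable_fun I (fun s => psi s x).
  exact: (measurable_potential chain ac_reparam reparam_pos).
have mh : measurable_fun I h by exact: measurable_wmean.
have aeF : Filter (almost_everywhere leb) by exact: (ae_filter_ringOfSetsType leb).
have aechi : {ae leb, forall t : R, t \in `]0, 1[ ->
    forall x, is_derive t 1 (fun s => reparam s x) (chi x t)}.
  have H x : {ae leb, forall t : R, t \in `]0, 1[ ->
      is_derive t 1 (fun s => reparam s x) (chi x t)} by have [] := chiP x.
  by have := filter_forall aeF H; apply: filterS => t Ht t01 x; exact: Ht.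
have ce : CE K p (gam 0) (gam 1) reparam psi h.
  split => //.
  - exact: ac_reparam.
  - by move=> t t01 x; apply/ltW/reparam_pos.
  - move: (@ae_interior R) aechi; apply: filterS2 => t int der t01 x.
    have -> : velocity reparam t x = chi x t.
      by rewrite /velocity derive1E; have [_ ->] := der (int t01) x.
    exact: (potentialP chain (chi^~ t) x (reparam_pos t01)).
  - by rewrite /reparam sig0.
  - by rewrite /reparam sig1.
have mk : measurable_fun I (fun s => kinetic K varpi (reparam s) (psi s)).
  apply: measurable_kinetic => //.
    by move=> x; apply: abs_continuous_measurable => //; exact: ac_reparam.
  by move=> t t01 x; apply/ltW/reparam_pos.
have act_le : (action K varpi a b reparam psi h <= (Z ^+ 2)%:E)%E.
  rewrite (action_integral a b chain mh mk).
  apply: (@le_trans _ _ (\int[leb]_(t in I) (Z ^+ 2)%:E)%E); last first.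
    by rewrite integral_cst//= lebesgue_measure_itv /= lte_fin ltr01 oppr0 adde0 mule1.
  apply: ae_le_integral_measurable_right => //.
    move=> t _; rewrite lee_fin; apply: addr_ge0; apply: mulr_ge0;
      rewrite ?sqr_ge0 ?(kinetic_ge0 chain)//.
  move: (@ae_interior R) aechi; apply: filterS2 => t int der t01.
  (* Since [psi] and [h] come from the tangent decomposition, the action density is the squared
     metric speed. *)
  rewrite lee_fin -(metric_kinetic chain a b (chi^~ t) (reparam_pos t01)).
  by apply: reparam_speed_le; [exact: int|exact/der/int].
rewrite /dynamic_dist (_ : Z%:E = sqrte (Z ^+ 2)%:E); last first.
  by rewrite /= sqrtr_sqr ger0_norm// ltW.
rewrite lee_sqrt ?lee_fin ?sqr_ge0//; apply: ge_ereal_inf.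
by exists (action K varpi a b reparam psi h) => //; exists reparam, psi, h.
Qed.

End Reparametrisation.

(** * From modified arc length to the length of a positive curve *)

Section DynamicLeLength.
Context {R : realType} {X : finType}.
Variables (K : X -> X -> R) (varpi p : X -> R) (a b : R).
Hypothesis chain : reversible_chain K varpi p.
Local Notation leb := (@lebesgue_measure R).
Local Notation g := (metric K varpi p a b).
Local Notation I := (`[0, 1]%classic : set R).

Lemma dynamic_dist_le_curve_length m0 m1 gam : joining_curves m0 m1 gam ->
  (dynamic_dist K varpi p a b m0 m1 <= curve_length g gam)%E.
Proof.
move=> [ac_gam gam_pos <- <-].
have /choice[phi phiP] : forall x, exists phi : R -> R,
    [/\ leb.-integrable setT (EFin \o phi),
      forall s t, 0 <= s -> s <= t -> t <= 1 ->
        gam t x - gam s x = \int[leb]_(r in `]s, t]) phi r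
    & {ae leb, forall t : R, t \in `]0, 1[ -> is_derive t 1 (fun s => gam s x) (phi t)}].
  by move=> x; exact: abs_continuous_FTC (ac_gam x).
have int_phi x : leb.-integrable setT (EFin \o phi x) by have [] := phiP x.
have gamE x s t : 0 <= s -> s <= t -> t <= 1 ->
    gam t x - gam s x = \int[leb]_(r in `]s, t]) phi x r.
  by have [_ H _] := phiP x; exact: H.
have mI : measurable (I : set (measurableTypeR R)) by exact: measurable_itv.
have mphi x : measurable_fun I (phi x).
  by apply: measurable_funTS; have /integrableP[/measurable_EFinP] := int_phi x.
pose v := speed K varpi p a b gam phi.
have mv : measurable_fun I (EFin \o v).
  apply/measurable_EFinP; apply: measurableT_comp.
    by apply: continuous_measurable_fun; exact: sqrt_continuous.
  exact: measurable_metric.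
have v0 t : (0 <= (v t)%:E)%E by rewrite lee_fin sqrtr_ge0.
have aeF : Filter (almost_everywhere leb) by exact: (ae_filter_ringOfSetsType leb).
have v_le : (\int[leb]_(t in I) (v t)%:E <= curve_length g gam)%E.
  apply: ae_le_integral_measurable_left => //.
  have H x : {ae leb, forall t : R, t \in `]0, 1[ -> is_derive t 1 (fun s => gam s x) (phi x t)}.
    by have [] := phiP x.
  move: (@ae_interior R) (filter_forall aeF H); apply: filterS2 => t int der t01.
  have -> : velocity gam t = phi^~ t.
    apply/funext => x; rewrite /velocity derive1E.
    by have [_ ->] := der x (int t01).
  by [].
(* An infinite length leaves nothing to prove; otherwise the speed is integrable and arc length is
   defined. *)
have [fin|] := ltP (\int[leb]_(t in I) (v t)%:E)%E +oo%E; last first.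
  by rewrite leye_eq => /eqP E; move: v_le; rewrite E leye_eq => /eqP ->; rewrite leey.
have int_v : leb.-integrable I (EFin \o v).
  apply/integrableP; split => //.
  apply: le_lt_trans fin; apply: ge0_le_integralW => t _ //.
  by rewrite gee0_abs; [exact: lexx|exact: v0].
apply: le_trans v_le.
have -> : (\int[leb]_(t in I) (v t)%:E = (\int[leb]_(t in I) v t)%:E)%E.
  by rewrite fineK// ge0_fin_numE// integral_ge0.
set L := \int[leb]_(t in I) v t.
have int_q : leb.-integrable I (EFin \o (fun t => 1 + \sum_x `|phi x t|)).
  apply: integrable_addr => //.
    by apply: continuous_integrable_itv => t; exact: cst_continuous.
  apply: integrable_sumr => // x; apply: integrable_absr.
  exact: integrableS (int_phi x).
set Q := \int[leb]_(t in I) (1 + \sum_x `|phi x t|).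
have Q0 : 0 <= Q by apply: Rintegral_ge0 => t _; rewrite addr_ge0// sumr_ge0.
apply/lee_addgt0Pr => e e0.
have Q1 : 0 < Q + 1 by rewrite ltr_wpDl.
(* The modified arc length exceeds the length by [eps * Q], which this choice keeps below [e] even
   when [Q] is small. *)
pose eps := e / (Q + 1); have eps0 : 0 < eps by rewrite divr_gt0.
have [sig sigP] := arc_length_inverse int_phi eps0 int_v.
apply: (le_trans (dynamic_dist_le_arc_length chain ac_gam gam_pos int_phi gamE eps0 int_v sigP)).
rewrite -EFinD lee_fin /arc_length /mod_speed RintegralD//; last exact: integrable_mulr.
rewrite lerD2l RintegralZl// -/Q /eps mulrAC ler_pdivrMr//.
by rewrite ler_pM2l// lerDl.
Qed.

Lemma dynamic_dist_le_length_dist m0 m1 :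
  (dynamic_dist K varpi p a b m0 m1 <= length_dist g m0 m1)%E.
Proof.
apply: le_ereal_inf_tmp => _ [gam jgam <-]; exact: dynamic_dist_le_curve_length.
Qed.

End DynamicLeLength.

Theorem theorem4p2 (R : realType) (X : finType) (K : X -> X -> R)
    (varpi p : X -> R) (a b : R)
    (K_markov : markov_kernel K)
    (K_irreducible : irreducible_kernel K)
    (varpi_steady : steady_state K varpi)
    (varpi_reversible : reversible K varpi)
    (a_gt0 : 0 < a) (b_gt0 : 0 < b)
    (p_pos : pos_measures p) (p_norm : l1norm varpi p = 1) :
  smooth_riemannian_metric (metric K varpi p a b) /\
  (forall m0 m1 : X -> R, pos_measures m0 -> pos_measures m1 ->
     length_dist (metric K varpi p a b) m0 m1 =
     dynamic_dist K varpi p a b m0 m1).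
Proof.
have chain : reversible_chain K varpi p by [].
split; first exact: metric_smooth_riemannian.
move=> m0 m1 m0_pos m1_pos; apply/eqP; rewrite eq_le.
by rewrite (length_dist_le_dynamic_dist _ _ chain)// (dynamic_dist_le_length_dist _ _ chain).
Qed.
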